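(* Let $(S,P)$ be a $\Gamma$-contraction on a Hilbert space $\mathcal H$, and let $\tau$ be an automorphism of the open symmetrized bidisc $G$, so that $\tau=\tau_m$, i.e. $\tau(z_1+z_2,z_1z_2)=(m(z_1)+m(z_2),m(z_1)m(z_2))$ for $z_1,z_2\in\mathbb D$, where $m(z)=\beta\frac{z-a}{1-\bar a z}$ for some $a\in\mathbb D$ and $\beta\in\mathbb T$. Let $(S_\tau,P_\tau)=\tau(S,P)$, and let $F\in\mathcal B(\mathcal D_P)$ and $F_\tau\in\mathcal B(\mathcal D_{P_\tau})$ be the fundamental operators of $(S,P)$ and $(S_\tau,P_\tau)$ respectively. Then there is a unitary $U:\mathcal D_{P_\tau}\to\mathcal D_P$ such that $$F_\tau=U^*\big((1+|a|^2)-\bar aF-aF^*\big)^{-\frac12}\,\beta\,(F+a^2F^*-2a)\,\big((1+|a|^2)-\bar aF-aF^*\big)^{-\frac12}U$$ (where scalars denote multiples of the identity on $\mathcal D_P$, and the self-adjoint operator $(1+|a|^2)-\bar aF-aF^*$ on $\mathcal D_P$ is positive and invertible, so that the formula makes sense).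
   Context: All Hilbert spaces are complex; $\mathbb D$ is the open unit disc and $\mathbb T$ the unit circle. Let $\Gamma=\{(z_1+z_2,z_1z_2): |z_1|\le 1,\ |z_2|\le 1\}\subseteq\mathbb C^2$ (the closed symmetrized bidisc) and $G=\{(z_1+z_2,z_1z_2): |z_1|<1,\ |z_2|<1\}$ (the open symmetrized bidisc). A pair $(S,P)$ of commuting bounded operators on a Hilbert space $\mathcal H$ is a $\Gamma$-contraction if $\Gamma$ is a spectral set for it; since $\Gamma$ is polynomially convex, this is equivalent to $\|p(S,P)\|\le \sup_{z\in\Gamma}|p(z)|$ for every complex polynomial $p$ in two variables. Then $P$ is a contraction. For a contraction $P$, put $D_P=(I-P^*P)^{1/2}$ and $\mathcal D_P=\overline{\mathrm{Ran}}\,D_P$. The fundamental operator of a $\Gamma$-contraction $(S,P)$ is the unique $F\in\mathcal B(\mathcal D_P)$ satisfying $S-S^*P=D_PFD_P$ (existence and uniqueness are known for every $\Gamma$-contraction; it is also known that the numerical radius of $F$ is at most $1$). It is known that every automorphism of $G$ is of the form $\tau_m$ for an automorphism $m$ of $\mathbb D$. The map $\tau_m$ extends holomorphically to a neighbourhood of $\Gamma$ and maps $\Gamma$ into itself. The joint spectrum of a $\Gamma$-contraction lies in $\Gamma$, so $\tau(S,P)$ is defined by the holomorphic functional calculus; it is a $\Gamma$-contraction. Explicitly, for $m(z)=\beta\frac{z-a}{1-\bar a z}$, $$S_\tau=\beta\big((1+|a|^2)S-2\bar aP-2a\big)(I-\bar aS+\bar a^2P)^{-1},\qquad P_\tau=\beta^2(P-aS+a^2)(I-\bar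 aS+\bar a^2P)^{-1}.$$ *)

(* Defs.v *)
From HB Require Import structures.
From mathcomp Require Import all_boot all_order all_algebra.
From mathcomp Require Import complex.
From mathcomp Require Import all_classical all_reals all_analysis.
Set Implicit Arguments.
Unset Strict Implicit.
Unset Printing Implicit Defensive.
Import Order.TTheory GRing.Theory Num.Theory.
Import numFieldNormedType.Exports.
Local Open Scope ring_scope.
Local Open Scope classical_set_scope.


(* By [linear_bounded_continuous], a linear map is bounded iff continuous. *)
Record bop (K : numFieldType) (V W : normedModType K) := Bop {
  bop_fun :> V -> W;
  bop_linear : linear bop_fun;
  bop_cont : continuous bop_fun }.

Notation "''B' ( V , W )" := (bop V W)
  (at level 8, format "''B' ( V ,  W )") : type_scope.
Notation "''B' ( V )" := (bop V V)
  (at level 8, format "''B' ( V )") : type_scope.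

HB.instance Definition _ (K : numFieldType) (V W : normedModType K)
  (A : 'B(V, W)) := GRing.isLinear.Build K V W _ (bop_fun A) (bop_linear A).

HB.instance Definition _ (K : numFieldType) (V W : normedModType K) :=
  gen_eqMixin 'B(V, W).
HB.instance Definition _ (K : numFieldType) (V W : normedModType K) :=
  gen_choiceMixin 'B(V, W).

Section BopModule.
Context (K : numFieldType) (V W : normedModType K).
Implicit Types A B C : 'B(V, W).

Lemma bopP A B : (forall x, A x = B x) -> A = B.
Proof.
case: A B => [f fl fc] [g gl gc] /= /funext fg; subst g.
by congr Bop; exact: Prop_irrelevance.
Qed.

Lemma bop_zero_linear : linear (fun _ : V => 0 : W).
Proof. by move=> a x y; rewrite scaler0 addr0. Qed.

Definition bop_zero : 'B(V, W) :=
  Bop bop_zero_linear (fun x => cvg_cst 0).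

Lemma bop_opp_linear A : linear (fun x : V => - A x : W).
Proof. by move=> a x y; rewrite linearP opprD scalerN. Qed.

Lemma bop_opp_cont A : continuous (fun x : V => - A x : W).
Proof. by move=> x; apply: cvgN; exact: bop_cont. Qed.

Definition bop_opp A : 'B(V, W) := Bop (bop_opp_linear A) (@bop_opp_cont A).

Lemma bop_add_linear A B : linear (fun x : V => A x + B x : W).
Proof. by move=> a x y; rewrite !linearP scalerDr addrACA. Qed.

Lemma bop_add_cont A B : continuous (fun x : V => A x + B x : W).
Proof. by move=> x; apply: cvgD; exact: bop_cont. Qed.

Definition bop_add A B : 'B(V, W) :=
  Bop (bop_add_linear A B) (@bop_add_cont A B).

Lemma bop_scale_linear k A : linear (fun x : V => k *: A x : W).
Proof. by move=> a x y; rewrite linearP scalerDr !scalerA mulrC. Qed.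

Lemma bop_scale_cont k A : continuous (fun x : V => k *: A x : W).
Proof. by move=> x; apply: cvgZl_tmp; exact: bop_cont. Qed.

Definition bop_scale k A : 'B(V, W) :=
  Bop (bop_scale_linear k A) (@bop_scale_cont k A).

Lemma bop_addA : associative bop_add.
Proof. by move=> A B C; apply: bopP => x /=; rewrite addrA. Qed.
Lemma bop_addC : commutative bop_add.
Proof. by move=> A B; apply: bopP => x /=; rewrite addrC. Qed.
Lemma bop_add0 : left_id bop_zero bop_add.
Proof. by move=> A; apply: bopP => x /=; rewrite add0r. Qed.
Lemma bop_addN : left_inverse bop_zero bop_opp bop_add.
Proof. by move=> A; apply: bopP => x /=; rewrite addNr. Qed.

HB.instance Definition _ := GRing.isZmodule.Build 'B(V, W)
  bop_addA bop_addC bop_add0 bop_addN.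

Lemma bop_scaleA a b A : bop_scale a (bop_scale b A) = bop_scale (a * b) A.
Proof. by apply: bopP => x /=; rewrite scalerA. Qed.
Lemma bop_scale1 : left_id 1 bop_scale.
Proof. by move=> A; apply: bopP => x /=; rewrite scale1r. Qed.
Lemma bop_scaleDr : right_distributive bop_scale +%R.
Proof. by move=> a A B; apply: bopP => x /=; rewrite scalerDr. Qed.
Lemma bop_scaleDl A : {morph bop_scale^~ A : a b / a + b}.
Proof. by move=> a b; apply: bopP => x /=; rewrite scalerDl. Qed.

HB.instance Definition _ := GRing.Zmodule_isLmodule.Build K 'B(V, W)
  bop_scaleA bop_scale1 bop_scaleDr bop_scaleDl.

End BopModule.

Section BopComp.
Context (K : numFieldType) (U V W : normedModType K).

Lemma bop_comp_linear (A : 'B(V, W)) (B : 'B(U, V)) :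
  linear (fun x : U => A (B x) : W).
Proof. by move=> a x y; rewrite !linearP. Qed.

Lemma bop_comp_cont (A : 'B(V, W)) (B : 'B(U, V)) :
  continuous (fun x : U => A (B x) : W).
Proof. by move=> x; apply: continuous_comp; exact: bop_cont. Qed.

Definition bop_comp (A : 'B(V, W)) (B : 'B(U, V)) : 'B(U, W) :=
  Bop (bop_comp_linear A B) (@bop_comp_cont A B).

End BopComp.

Notation "A *o B" := (bop_comp A B)
  (at level 40, left associativity, format "A  *o  B") : ring_scope.

Section BopRing.
Context (K : numFieldType) (V : normedModType K).
Implicit Types A B C : 'B(V).

Definition bop_id : 'B(V) := @Bop K V V id (fun a x y => erefl) (fun x => cvg_id).

Lemma bop_compA : associative (@bop_comp K V V V).
Proof. by move=> A B C; apply: bopP. Qed.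
Lemma bop_comp1l : left_id bop_id (@bop_comp K V V V).
Proof. by move=> A; apply: bopP. Qed.
Lemma bop_comp1r : right_id bop_id (@bop_comp K V V V).
Proof. by move=> A; apply: bopP. Qed.
Lemma bop_compDl : left_distributive (@bop_comp K V V V) +%R.
Proof. by move=> A B C; apply: bopP. Qed.
Lemma bop_compDr : right_distributive (@bop_comp K V V V) +%R.
Proof. by move=> A B C; apply: bopP => x /=; rewrite linearD. Qed.

HB.instance Definition _ := GRing.Zmodule_isPzRing.Build 'B(V)
  bop_compA bop_comp1l bop_comp1r bop_compDl bop_compDr.

(* Junk value [0] when [A] has no bounded inverse. *)
Definition binvertible A := exists B : 'B(V), A * B = 1 /\ B * A = 1.
Definition binv A : 'B(V) := xget 0 [set B : 'B(V) | A * B = 1 /\ B * A = 1].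

End BopRing.

Definition opnorm (R : realType) (V W : normedModType R[i]) (A : 'B(V, W)) : R :=
  sup [set complex.Re `|A x| | x in [set x : V | `|x| <= 1]].


HB.mixin Record NormedModule_hasInner (R : realType) V
    & NormedModule R[i] V := {
  inner_form : {dot V for (Num.conj : R[i] -> R[i])};
  sqr_normE : forall x : V, `|x| ^+ 2 = inner_form x x }.

#[short(type="hilbertType")]
HB.structure Definition Hilbert (R : realType) :=
  {V of CompleteNormedModule R[i] V & NormedModule_hasInner R V}.

Definition inner (R : realType) (H : hilbertType R) (x y : H) : R[i] :=
  @inner_form R H x y.
Notation "''[' x , y ]" := (inner x y) : ring_scope.

Section HilbertOps.
Context (R : realType).

(* The adjoint always exists (Riesz), the positive square root exists for
   [bpos A]; both are then unique. *)
Definition badj (H K : hilbertType R) (A : 'B(H, K)) : 'B(K, H) :=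
  xget 0 [set B : 'B(K, H) | forall x y, '[A x, y] = '[x, B y]].

(* [0 <= z] in [R[i]] entails that [z] is real: such operators are self-adjoint. *)
Definition bpos (H : hilbertType R) (A : 'B(H)) :=
  forall x : H, 0 <= '[A x, x].

Definition bsqrt (H : hilbertType R) (A : 'B(H)) : 'B(H) :=
  xget 0 [set B : 'B(H) | bpos B /\ B * B = A].

Definition bunitary (H K : hilbertType R) (U : 'B(H, K)) :=
  badj U *o U = 1 /\ U *o badj U = 1.

End HilbertOps.
Notation "A ^*o" := (badj A) (at level 2, format "A ^*o") : ring_scope.


Record csubspace (R : realType) (H : hilbertType R) := CSubspace {
  cs_set : set H;
  cs_submod : submod_closed [pred x | x \in cs_set];
  cs_closed : closed cs_set }.

Section ClosedSubspace.
Context (R : realType) (H : hilbertType R) (M : csubspace H).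

Definition csub : Type := {x : H | [pred y | y \in cs_set M] x}.
HB.instance Definition _ := SubChoice.on csub.
HB.instance Definition _ :=
  GRing.SubChoice_isSubLmodule.Build R[i] H _ csub (cs_submod M).

Definition csub_norm (x : csub) : R[i] := `|val x|.

Lemma csub_normD x y : csub_norm (x + y) <= csub_norm x + csub_norm y.
Proof. exact: ler_normD. Qed.
Lemma csub_normZ (a : R[i]) x : csub_norm (a *: x) = `|a| * csub_norm x.
Proof. by rewrite /csub_norm linearZ normrZ. Qed.
Lemma csub_norm0 x : csub_norm x = 0 -> x = 0.
Proof. by move/normr0_eq0 => x0; apply: val_inj; rewrite x0 linear0. Qed.

HB.instance Definition _ :=
  Lmodule_isNormed.Build R[i] csub csub_normD csub_normZ csub_norm0.


Lemma csub_normE (x : csub) : `|x| = `|val x|. Proof. by []. Qed.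

Lemma csub_cvg (F : set_system csub) : ProperFilter F -> cauchy F -> cvg F.
Proof.
move=> FF /cauchy_ballP Fc.
have : cauchy (val @ F).
  apply/cauchy_ballP => e e0; have := Fc e e0.
  rewrite !near_simpl.
  case=> -[A B] [/= FA FB] AB.
  exists (val @` A, val @` B).
    by split=> /=; [apply: filterS FA|apply: filterS FB] => x ?; exists x.
  case=> _ _ [/= [x Ax <-] [y By <-]].
  by have := AB (x, y) (conj Ax By); rewrite /= -!ball_normE /=.
move/cauchy_cvg => /cvg_ex[l Fl].
have Ml : cs_set M l.
  apply: (closed_cvg (cs_set M) (@cs_closed _ _ M) _ l Fl).
  by apply: nearW => x; have := valP x; rewrite /= inE.
have Ml' : [pred y | y \in cs_set M] l by rewrite /= inE.
apply/cvg_ex; exists (exist _ l Ml' : csub).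
apply/cvgrPdist_lt => e e0.
by move/cvgrPdist_lt: Fl => /(_ e e0).
Qed.

HB.instance Definition _ := Uniform_isComplete.Build csub csub_cvg.

Definition csub_form (x y : csub) : R[i] := inner_form (val x) (val y).

Lemma csub_formBl y : zmod_morphism (csub_form ^~ y).
Proof. by move=> u v; rewrite /csub_form linearB linearBl. Qed.
Lemma csub_formBr x : zmod_morphism (csub_form x).
Proof. by move=> u v; rewrite /csub_form !linearB. Qed.
Lemma csub_formZl y : scalable_for *%R (csub_form ^~ y).
Proof. by move=> a u; rewrite /csub_form linearZ /= linearZl_LR. Qed.
Lemma csub_formZr x : scalable_for (Num.conj \; *%R) (csub_form x).
Proof. by move=> a u; rewrite /csub_form linearZ. Qed.

HB.instance Definition _ := isBilinear.Build R[i] csub csub R[i]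
  *%R (Num.conj \; *%R) csub_form
  csub_formBl csub_formBr csub_formZl csub_formZr.

Lemma csub_form_herm x y :
  csub_form x y = (-1) ^+ false * Num.conj (csub_form y x).
Proof. exact: hermitian_subproof. Qed.

HB.instance Definition _ := isHermitianSesquilinear.Build R[i] csub
  false Num.conj csub_form csub_form_herm.

Lemma csub_form_pos x : x != 0 -> 0 < csub_form x x.
Proof. by move=> x0; apply: neq0_dnorm_gt0. Qed.

HB.instance Definition _ := isDotProduct.Build R[i] csub csub_form
  csub_form_pos.

Lemma csub_sqr_normE x : `|x| ^+ 2 = csub_form x x.
Proof. exact: sqr_normE. Qed.

HB.instance Definition _ :=
  NormedModule_hasInner.Build R csub csub_sqr_normE.

End ClosedSubspace.

Coercion csub : csubspace >-> Sortclass.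

Section ClosedRange.
Context (R : realType) (H K : hilbertType R) (A : 'B(H, K)).

Lemma closure_range_submod :
  submod_closed [pred y | y \in closure (range A)].
Proof.
split=> [|a y z]; rewrite !inE.
  by apply: subset_closure; exists 0 => //; rewrite linear0.
move=> yA zA B azB.
have /(_ _ azB)[/= [U V] [/= yU zV] UV] :
    a *: uv.1 + uv.2 @[uv --> (y, z)] --> a *: y + z.
  by apply: cvgD; [apply: cvgZl_tmp; exact: cvg_fst|exact: cvg_snd].
have [_ [[u _ <-] Uu]] := yA _ yU.
have [_ [[v _ <-] Vv]] := zA _ zV.
exists (a *: A u + A v); split; first by exists (a *: u + v); rewrite ?linearP.
exact: (UV (A u, A v)).
Qed.

Definition closed_range : csubspace K :=
  CSubspace closure_range_submod (@closed_closure _ _).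

Lemma closed_range_subproof x : [pred y | y \in cs_set closed_range] (A x).
Proof. by apply/mem_set/subset_closure; exists x. Qed.

Definition to_range (x : H) : closed_range :=
  exist _ (A x) (closed_range_subproof x).

End ClosedRange.


Section SymBidisc.
Context (R : realType).
Implicit Types (z s : R[i]^o * R[i]^o).

Definition symG : set (R[i]^o * R[i]^o) :=
  [set s | exists z1 z2 : R[i],
    [/\ `|z1| < 1, `|z2| < 1 & s = (z1 + z2, z1 * z2)]].

Definition symGamma : set (R[i]^o * R[i]^o) :=
  [set s | exists z1 z2 : R[i],
    [/\ `|z1| <= 1, `|z2| <= 1 & s = (z1 + z2, z1 * z2)]].

(* For [R[i]]-normed modules, [differentiable] is complex differentiability. *)
Definition automorphism_symG (tau : R[i]^o * R[i]^o -> R[i]^o * R[i]^o) :=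
  exists sigma : R[i]^o * R[i]^o -> R[i]^o * R[i]^o,
    [/\ {homo tau : s / symG s}, {homo sigma : s / symG s},
        forall s, symG s -> sigma (tau s) = s,
        forall s, symG s -> tau (sigma s) = s &
        forall s, symG s -> differentiable tau s /\ differentiable sigma s].

Definition disc_aut (a b z : R[i]) : R[i] := b * (z - a) / (1 - a^* * z).

(* [p : {poly {poly R[i]}}] stands for
   \sum_j \sum_k p`_j`_k * s1 ^ j * s2 ^ k. *)
Definition poly_eval (p : {poly {poly R[i]}}) s : R[i] := p.[s.1%:P].[s.2].

Context (H : hilbertType R).
Implicit Types S P T : 'B(H).

Definition poly_op S P (p : {poly {poly R[i]}}) : 'B(H) :=
  \sum_(j < size p) \sum_(k < size p`_j) p`_j`_k *: (S ^+ j * P ^+ k).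

(* [symGamma] is polynomially convex, so that being a spectral set can be tested
   on polynomials. *)
Definition Gamma_contraction S P :=
  S * P = P * S /\
  forall p : {poly {poly R[i]}},
    opnorm (poly_op S P p) <=
      sup [set complex.Re `|poly_eval p s| | s in symGamma].

(* The functional calculus of a [Gamma]-contraction. A function holomorphic near
   the polynomially convex set [symGamma] is, by Oka-Weil, a uniform limit there
   of polynomials p_n, and f(S, P) is then the norm limit of p_n(S, P); since
   [symGamma] is a spectral set the limit does not depend on (p_n). As [symG] is
   dense in [symGamma], uniform convergence on [symG] is the same thing, and [f]
   need only be known on [symG]. *)
Definition fun_calc S P (f : R[i]^o * R[i]^o -> R[i]^o) : 'B(H) :=
  xget 0 [set T : 'B(H) | exists p_ : nat -> {poly {poly R[i]}},
    {uniform symG, (fun n => poly_eval (p_ n) : _ -> R[i]^o) @ \oo --> f} /\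
    opnorm (poly_op S P (p_ n) - T) @[n --> \oo] --> (0 : R)].

Definition fun_calc2 S P (f : R[i]^o * R[i]^o -> R[i]^o * R[i]^o) :
    'B(H) * 'B(H) :=
  (fun_calc S P (fun s => (f s).1), fun_calc S P (fun s => (f s).2)).

Definition defect P : 'B(H) := bsqrt (1 - P^*o * P).

Definition defect_space P : csubspace H := closed_range (defect P).

Definition fundamental_operator S P
    (F : 'B(defect_space P)) :=
  forall h : H,
    (S - S^*o * P) h = defect P (val (F (to_range (defect P) h))).

End SymBidisc.

(* Main.v *)
(* Put [N = 1 - a^* S + a^*^2 P], [M = P - a S + a^2] and
   [T = (1 + |a|^2) S - 2 a^* P - 2 a].  As [Gamma] is a spectral set, [N] has a
   bounded inverse [Q], a norm limit of polynomials in [S] and [P], and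
   [Stau = b T Q], [Ptau = b^2 M Q].  With [D = defect P] and
   [X = (1 + |a|^2) - a^* F - a F^*], expanding gives
     N^* N - M^* M = (1 - |a|^2) D X D,
     N^* T - T^* M = (1 - |a|^2) D (F + a^2 F^* - 2 a) D.
   The function [(z1 - a)(z2 - a) / ((1 - a^* z1)(1 - a^* z2))] is bounded by 1,
   so [|M x| <= |N x|] and [X >= 0] for every [a] in the disc; comparing [a] with
   a slightly larger multiple of [a] makes [X] bounded below.  By the first
   identity, [defect Ptau] and [(1 - |a|^2)^(1/2) X^(1/2) D Q] give vectors the
   same norm, hence differ by a unitary [U]; the second identity and the
   uniqueness of the fundamental operator then give [Ftau]. *)
From HB Require Import structures.
Require Import Defs.
From mathcomp Require Import all_boot all_order all_algebra.
From mathcomp Require Import ring lra.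
From mathcomp Require Import complex.
From mathcomp Require Import all_classical all_reals all_analysis.
Set Implicit Arguments.
Unset Strict Implicit.
Unset Printing Implicit Defensive.
Import Order.TTheory GRing.Theory Num.Theory.
Import numFieldNormedType.Exports.
Local Open Scope ring_scope.
Local Open Scope classical_set_scope.

(** * Operator norms and completeness *)

Section RealNorm.
Local Open Scope complex_scope.
Context (R : realType).

(** [badj], [bsqrt], [binv] and [fun_calc] are choices with default value 0, so each has to be shown
    to meet its specification: adjoints and inverses by minimising a coercive functional, square
    roots by iteration, [fun_calc] by showing that any other approximating sequence gives the same
    operator. The last point has an obstacle: approximation is known on [symG], whereas the spectral
    inequality speaks of [symGamma]; polynomial bounds are carried from one to the other along
    radii. As [Q] need not be a polynomial in [S] and [P], estimates involving it run through
    explicit approximants with an error of geometric decay. [F] acts on [defect_space P] and is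
    known only through the form [<F D x, D y>]; hence operators on defect spaces are compared as
    sesquilinear forms on the dense range of [D]. Norms in an [R[i]]-module are complex numbers
    under a partial order; [rnorm] and [cabs] keep their real parts, so that real arithmetic
    applies. *)

Definition rnorm (V : normedModType R[i]) (x : V) : R := complex.Re `|x|.

Definition cabs (z : R[i]) : R := complex.Re `|z|.

Lemma Re_eqC (z : R[i]) : 0 <= z -> (complex.Re z)%:C = z.
Proof. by move=> z0; apply: RRe_real; exact: ger0_real. Qed.

Lemma cabsE z : (cabs z)%:C = `|z|. Proof. exact: Re_eqC. Qed.
Lemma cabs_ge0 z : 0 <= cabs z. Proof. by rewrite -lecR cabsE normr_ge0. Qed.
Lemma cabsM x y : cabs (x * y) = cabs x * cabs y.
Proof. by apply: complexI; rewrite rmorphM/= !cabsE normrM. Qed.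
Lemma cabsD x y : cabs (x + y) <= cabs x + cabs y.
Proof. by rewrite -lecR rmorphD/= !cabsE ler_normD. Qed.
Lemma cabsN x : cabs (- x) = cabs x.
Proof. by rewrite /cabs normrN. Qed.
Lemma cabs1 : cabs 1 = 1. Proof. by rewrite /cabs normr1. Qed.
Lemma cabs0 : cabs 0 = 0. Proof. by rewrite /cabs normr0. Qed.
Lemma cabsX x n : cabs (x ^+ n) = cabs x ^+ n.
Proof. by apply: complexI; rewrite rmorphXn/= !cabsE normrX. Qed.
Lemma cabsV x : cabs x^-1 = (cabs x)^-1.
Proof. by apply: complexI; rewrite fmorphV/= !cabsE normfV. Qed.
Lemma cabsR (x : R) : 0 <= x -> cabs x%:C = x.
Proof. by move=> x0; rewrite /cabs ger0_norm// ler0c. Qed.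
Lemma cabsJ x : cabs (x^*)%R = cabs x.
Proof. by rewrite /cabs norm_conjC. Qed.
Lemma cabs_eq0 x : (cabs x == 0) = (x == 0).
Proof. by rewrite -(inj_eq (@complexI R)) cabsE normr_eq0. Qed.
Lemma ler_Re_cabs z : complex.Re z <= cabs z.
Proof.
rewrite -lecR cabsE; apply: le_trans (normc_ge_Re z).
by rewrite lecR ler_norm.
Qed.

Section Normed.
Context (V : normedModType R[i]).
Implicit Types x y : V.
Lemma rnormE x : (rnorm x)%:C = `|x|. Proof. exact: Re_eqC. Qed.
Lemma rnorm_ge0 x : 0 <= rnorm x. Proof. by rewrite -lecR rnormE normr_ge0. Qed.
Lemma rnorm0 : rnorm (0 : V) = 0. Proof. by rewrite /rnorm normr0. Qed.
Lemma rnorm_eq0 x : (rnorm x == 0) = (x == 0).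
Proof. by rewrite -(inj_eq (@complexI R)) rnormE normr_eq0. Qed.
Lemma rnormD x y : rnorm (x + y) <= rnorm x + rnorm y.
Proof. by rewrite -lecR rmorphD/= !rnormE ler_normD. Qed.
Lemma rnormN x : rnorm (- x) = rnorm x.
Proof. by rewrite /rnorm normrN. Qed.
Lemma rdistC x y : rnorm (x - y) = rnorm (y - x).
Proof. by rewrite /rnorm distrC. Qed.
Lemma rnormB x y : rnorm (x - y) <= rnorm x + rnorm y.
Proof. by rewrite -(rnormN y) rnormD. Qed.
Lemma rnormZ k x : rnorm (k *: x) = cabs k * rnorm x.
Proof. by apply: complexI; rewrite rmorphM/= cabsE !rnormE normrZ. Qed.
Lemma rnorm_triangle x y z : rnorm (x - z) <= rnorm (x - y) + rnorm (y - z).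
Proof. by rewrite -{1}(subrK y x) -addrA rnormD. Qed.
End Normed.

(** Most limits below are taken with explicit error bounds; this lemma discards the error at the
    end. *)
Lemma le_lim0 (e : nat -> R) (K x y : R) : e n @[n --> \oo] --> (0 : R) ->
  (forall n, x <= y + K * e n) -> x <= y.
Proof.
move=> e0 xy.
have h : (y + K * e n) @[n --> \oo] --> y.
  by rewrite -[X in _ --> X]addr0 -(mulr0 K); apply: cvgD; [exact: cvg_cst|apply: cvgMr].
rewrite -(cvg_lim (@Rhausdorff R) h).
apply: limr_ge; first by apply/cvg_ex; exists y.
exact: nearW.
Qed.

(** Letting [m] tend to infinity in the hypothesis keeps the rate [e n], so later estimates can work
    with numbers instead of filters. *)
Lemma cauchy_bound (V : completeNormedModType R[i]) (u : nat -> V) (e : nat -> R) :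
  e n @[n --> \oo] --> (0 : R) ->
  (forall n m, rnorm (u n - u m) <= e n + e m) ->
  exists l, forall n, rnorm (u n - l) <= e n.
Proof.
move=> e0 ue.
have : cauchy (u n @[n --> \oo]).
  (* A radius that is positive in [R[i]] has zero imaginary part, hence is a real number. *)
  apply/cauchy_ballP => d; rewrite ltcE => /andP[/eqP/= dim d0].
  have d2 : 0 < complex.Re d / 2 by rewrite divr_gt0.
  have /cvgrPdist_lt/(_ _ d2) [N _ HN] := e0.
  exists ([set u n | n in [set n | (N <= n)%N]], [set u n | n in [set n | (N <= n)%N]]).
    by split; exists N => //= n /= Nn; exists n.
  move=> [_ _] [[n /= Nn <-] [m /= Nm <-]] /=.
  rewrite -ball_normE /= -rnormE ltcE/= -dim eqxx/=.
  apply: le_lt_trans (ue n m) _.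
  have := HN n Nn; have := HN m Nm; rewrite /= !sub0r !normrN.
  move=> h1 h2.
  have := ler_norm (e n); have := ler_norm (e m); lra.
move/cauchy_cvg => /cvg_ex[l ul].
exists l => n; apply/ler_addgt0Pr => d d0.
have d2 : 0 < d / 2 by rewrite divr_gt0.
have dC : 0 < (d / 2)%:C by rewrite ltcR.
have /cvgrPdist_lt/(_ _ dC) [N _ HN] := ul.
have /cvgrPdist_lt/(_ _ d2) [N' _ HN'] := e0.
have := HN (maxn N N') (leq_maxl _ _); rewrite -rnormE ltcR rdistC => h1.
have := HN' (maxn N N') (leq_maxr _ _); rewrite sub0r normrN => h2.
have := ler_norm (e (maxn N N')); have := ue n (maxn N N').
have := rnorm_triangle (u n) (u (maxn N N')) l.
lra.
Qed.

Lemma rnorm_le_continuous (V W : normedModType R[i]) (f : {linear V -> W}) (M : R) :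
  (forall x, rnorm (f x) <= M * rnorm x) -> continuous f.
Proof.
move=> fM; apply/linear_bounded_continuous/bounded_funP => r.
exists (`|M%:C| * r) => x xr; rewrite -rnormE.
apply: (@le_trans _ _ (M * rnorm x)%:C); first by rewrite lecR.
rewrite rmorphM/= rnormE.
have : M%:C * `|x| <= `|M%:C| * `|x|.
  apply: ler_wpM2r => //; apply: real_ler_norm.
  by apply/complex_realP; exists M.
by move/le_trans; apply; apply: ler_wpM2l.
Qed.

Lemma bop_of_bound (V W : normedModType R[i]) (f : V -> W) (M : R) :
  linear f -> (forall x, rnorm (f x) <= M * rnorm x) ->
  exists A : 'B(V, W), forall x, A x = f x.
Proof.
move=> fl fM.
pose g : {linear V -> W} := HB.pack f (GRing.isLinear.Build _ _ _ _ f fl).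
have gc : continuous f by exact: (@rnorm_le_continuous _ _ g M).
by exists (Bop fl gc).
Qed.

Section Opnorm.
Context (V W : normedModType R[i]).
Implicit Types A B : 'B(V, W).

Lemma bop_bounded A : exists2 M, 0 <= M & forall x, rnorm (A x) <= M * rnorm x.
Proof.
have /linear_bounded_continuous/linear_boundedP[M [Mr AM]] := @bop_cont _ _ _ A.
pose M' : R[i] := `|M| + 1.
have M1 : 0 <= M' by rewrite addr_ge0 ?normr_ge0 ?ler01.
have MM' : M < M'.
  by rewrite (le_lt_trans (real_ler_norm Mr)) ?ltrDl ?ltr01.
have [m mM] : exists m : R, m%:C = M' by exists (complex.Re M'); exact: Re_eqC.
exists m; first by rewrite -lecR mM.
by move=> x; rewrite -lecR rmorphM/= mM !rnormE; exact: AM.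
Qed.

Let unit_image A := [set complex.Re `|A x| | x in [set x : V | `|x| <= 1]].

Lemma opnorm_set_sup A : has_sup (unit_image A).
Proof.
split; first by exists (complex.Re `|A 0|), 0; rewrite //= normr0 ler01.
have [M M0 AM] := bop_bounded A; exists M => _ [x /= x1 <-].
apply: le_trans (AM x) _; rewrite -[leRHS]mulr1 ler_wpM2l//.
by rewrite -lecR rnormE.
Qed.

Lemma opnorm_le A c : 0 <= c -> (forall x, rnorm (A x) <= c * rnorm x) ->
  opnorm A <= c.
Proof.
move=> c0 Ac; apply: ge_sup; first by case: (opnorm_set_sup A).
move=> _ [x /= x1 <-]; apply: le_trans (Ac x) _; rewrite -[leRHS]mulr1 ler_wpM2l//.
by rewrite -lecR rnormE.
Qed.

Lemma opnorm_ge0 A : 0 <= opnorm A.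
Proof.
apply: (@le_trans _ _ (rnorm (A 0))); first exact: rnorm_ge0.
by apply: (ub_le_sup (proj2 (opnorm_set_sup A))); exists 0; rewrite //= normr0 ler01.
Qed.

Lemma le_opnorm A x : rnorm (A x) <= opnorm A * rnorm x.
Proof.
have [->|x0] := eqVneq x 0; first by rewrite linear0 !rnorm0 mulr0.
have xp : 0 < rnorm x by rewrite lt_def rnorm_eq0 x0 rnorm_ge0.
have : rnorm (A ((rnorm x)^-1%:C *: x)) <= opnorm A.
  apply: (ub_le_sup (proj2 (opnorm_set_sup A))).
  exists ((rnorm x)^-1%:C *: x) => //=.
  rewrite -rnormE rnormZ cabsR ?invr_ge0 ?rnorm_ge0// mulVf ?gt_eqF//.
by rewrite linearZ rnormZ cabsR ?invr_ge0 ?rnorm_ge0// ler_pdivrMl// mulrC.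
Qed.

End Opnorm.

Lemma opnormM (U V W : normedModType R[i]) (A : 'B(V, W)) (B : 'B(U, V)) :
  opnorm (A *o B) <= opnorm A * opnorm B.
Proof.
apply: opnorm_le => [|x]; first by rewrite mulr_ge0 ?opnorm_ge0.
apply: le_trans (le_opnorm A (B x)) _; rewrite -mulrA ler_wpM2l ?opnorm_ge0//.
exact: le_opnorm.
Qed.

(** Pointwise limits carry the error [rnorm x * e n], uniform on the unit ball; this yields
    linearity and boundedness of the limit and the same rate in operator norm. *)
Lemma opnorm_complete (V : normedModType R[i]) (W : completeNormedModType R[i])
    (A : nat -> 'B(V, W)) (e : nat -> R) : (forall n, 0 <= e n) ->
  e n @[n --> \oo] --> (0 : R) ->
  (forall n m, opnorm (A n - A m) <= e n + e m) ->
  exists L : 'B(V, W), forall n, opnorm (A n - L) <= e n.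
Proof.
move=> e0 ec Ae.
have /choice[L AL] : forall x, exists l, forall n, rnorm (A n x - l) <= rnorm x * e n.
  move=> x; apply: cauchy_bound; first by rewrite -(mulr0 (rnorm x)); exact: cvgMr.
  move=> n m; apply: le_trans (le_opnorm (A n - A m) x) _.
  by rewrite -mulrDr mulrC ler_wpM2l ?rnorm_ge0.
have Ll : linear L.
  move=> k x y; apply/eqP; rewrite -subr_eq0 -rnorm_eq0 eq_le rnorm_ge0 andbT.
  apply: (@le_lim0 e (rnorm (k *: x + y) + cabs k * rnorm x + rnorm y) _ _ ec) => n.
  rewrite add0r.
  have -> : L (k *: x + y) - (k *: L x + L y) =
     - (A n (k *: x + y) - L (k *: x + y)) + (k *: (A n x - L x) + (A n y - L y)).
    by rewrite [A n _]linearP scalerBr opprB [X in _ = _ + X]addrACA -(opprD (k *: L x)) addrA subrK.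
  apply: le_trans (rnormD _ _) _; rewrite rnormN !mulrDl -addrA lerD ?AL//.
  apply: le_trans (rnormD _ _) _; rewrite lerD ?AL// rnormZ -mulrA.
  by rewrite ler_wpM2l ?cabs_ge0.
have LM x : rnorm (L x) <= (opnorm (A 0) + e 0) * rnorm x.
  have -> : L x = A 0 x - (A 0 x - L x) by rewrite opprB addrC subrK.
  apply: le_trans (rnormB _ _) _; rewrite mulrDl lerD ?le_opnorm//.
  by rewrite mulrC AL.
have [T TL] := bop_of_bound Ll LM.
exists T => n; apply: opnorm_le => // x.
by rewrite mulrC /= TL.
Qed.

End RealNorm.

(** * Inner products, adjoints and square roots *)

Section Inner.
Local Open Scope complex_scope.
Context (R : realType) (H : hilbertType R).
Implicit Types x y z : H.

Lemma innerDl x y z : '[x + y, z] = '[x, z] + '[y, z].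
Proof. exact: linearDl. Qed.
Lemma innerZl k x z : '[k *: x, z] = k * '[x, z].
Proof. exact: linearZl_LR. Qed.
Lemma innerNl x z : '[- x, z] = - '[x, z].
Proof. exact: linearNl. Qed.
Lemma innerBl x y z : '[x - y, z] = '[x, z] - '[y, z].
Proof. by rewrite innerDl innerNl. Qed.
Lemma innerC x y : '[x, y] = ('[y, x]^*)%R.
Proof. by rewrite /inner hermitian_subproof expr0 mul1r. Qed.
Lemma innerDr x y z : '[x, y + z] = '[x, y] + '[x, z].
Proof. exact: linearDr. Qed.
Lemma innerZr k x z : '[x, k *: z] = (k^*)%R * '[x, z].
Proof. by rewrite innerC innerZl rmorphM/= -innerC. Qed.
Lemma innerNr x z : '[x, - z] = - '[x, z].
Proof. exact: linearNr. Qed.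
Lemma innerBr x y z : '[x, y - z] = '[x, y] - '[x, z].
Proof. by rewrite innerDr innerNr. Qed.
Lemma inner0l z : '[0, z] = 0.
Proof. by rewrite -(scale0r 0) innerZl mul0r. Qed.
Lemma innerxx x : '[x, x] = (rnorm x ^+ 2)%:C.
Proof. by rewrite rmorphXn/= rnormE sqr_normE. Qed.

Definition innerE := (innerBl, innerBr, innerDl, innerDr, innerNl, innerNr, innerZl, innerZr).

Lemma inner_eq0 x : (forall y, '[y, x] = 0) -> x = 0.
Proof.
move=> /(_ x); rewrite innerxx => /(@complexI R _ 0)/eqP.
by rewrite sqrf_eq0 rnorm_eq0 => /eqP.
Qed.

Lemma inner_inj x y : (forall z, '[z, x] = '[z, y]) -> x = y.
Proof.
by move=> xy; apply/eqP; rewrite -subr_eq0; apply/eqP/inner_eq0 => z;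
  rewrite innerBr xy subrr.
Qed.

End Inner.

Section PosOp.
Local Open Scope complex_scope.
Context (R : realType) (H : hilbertType R).
Implicit Types (x y z : H) (A : 'B(H)).

Lemma conj_eqR (z : R[i]) : 0 <= z -> (z^*)%R = z.
Proof. by move=> z0; apply/CrealP; exact: ger0_real. Qed.

Lemma conj_i : ('i%C : R[i])^*%R = - 'i%C.
Proof. by rewrite complexiE conjCi. Qed.

(** Polarisation: [<A (x + k y), x + k y>] is real, and the cases [k = 1] and [k = i] together
    separate the two cross terms. *)
Lemma bpos_self_adjoint A : bpos A -> forall x y, '[A x, y] = '[x, A y].
Proof.
move=> A0 x y; rewrite [RHS]innerC.
have h k : k * '[A y, x] + (k^*)%R * '[A x, y] =
   (k^*)%R * ('[A y, x])^*%R + k * ('[A x, y]^*)%R.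
  have := conj_eqR (A0 (x + k *: y)).
  rewrite linearD linearZ !innerE !(rmorphD, rmorphM) /= conjCK.
  rewrite (conj_eqR (A0 x)) (conj_eqR (A0 y)) => e.
  apply: (addrI ('[A x, x])); apply: (addIr (k * ((k^*)%R * '[A y, y]))).
  rewrite [RHS](_ : _ = '[A x, x] + (k^*)%R * ('[A y, x])^*%R +
       (k * ('[A x, y])^*%R + (k^*)%R * (k * '[A y, y]))); last by ring.
  by rewrite e; ring.
have := h 1; have := h 'i%C; rewrite conj_i conjC1 !mulNr !mul1r => h1 h2.
have i0 : 'i%C != 0 :> R[i] by rewrite eq_complex/= oner_eq0 andbF.
have {h1} : '[A y, x] - '[A x, y] = - ('[A y, x]^*)%R + ('[A x, y]^*)%R.
  by apply: (mulfI i0); rewrite mulrBr h1 mulrDr mulrN.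
move=> h1.
have h2' : 2 * '[A x, y] = 2 * ('[A y, x]^*)%R.
  transitivity (('[A y, x] + '[A x, y]) - ('[A y, x] - '[A x, y])); first by ring.
  by rewrite h2 h1; ring.
have : (2 : R[i]) != 0 by rewrite pnatr_eq0.
by move/mulfI; apply.
Qed.

(** The form [<A x, y>] may be degenerate, so the discriminant argument is split according to
    whether the diagonal values vanish. [A = 1] gives the usual inequality. *)
Lemma bpos_cauchy_schwarz A x y : bpos A ->
  cabs '[A x, y] ^+ 2 <= complex.Re '[A x, x] * complex.Re '[A y, y].
Proof.
move=> A0.
pose p u := complex.Re '[A u, u].
have pE u : '[A u, u] = (p u)%:C by rewrite Re_eqC//; exact: A0.
have p0 u : 0 <= p u by rewrite -lecR -pE; exact: A0.
pose c := '[A x, y].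
have cE : '[A y, x] = (c^*)%R by rewrite (bpos_self_adjoint A0) -innerC.
have key (s : R) (k : R[i]) :
  0 <= ((s ^+ 2 * p x)%:C + (s%:C * ((k^*)%R * c + k * (c^*)%R)) + (cabs k ^+ 2 * p y)%:C).
  have := A0 (s%:C *: x + k *: y).
  rewrite linearD !linearZ !innerE !pE cE -/c.
  have sJ : ((s%:C)^*)%R = s%:C by apply/CrealP/complex_realP; exists s.
  rewrite sJ => h; apply: le_trans h _.
  rewrite le_eqVlt; apply/orP; left; apply/eqP.
  rewrite !(rmorphXn, rmorphM)/= cabsE normCK; ring.
have cc : c * (c^*)%R = (cabs c ^+ 2)%:C by rewrite rmorphXn/= cabsE normCK.
rewrite -/c -/(p x) -/(p y).
(* The coefficient [k = - t c] aligns the phase of the cross term, which leaves a quadratic form in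
   two real variables. *)
have gen (s t : R) : 0 <= s ^+ 2 * p x - 2 * s * t * cabs c ^+ 2 + t ^+ 2 * cabs c ^+ 2 * p y.
  have := key s (- (t%:C * c)).
  rewrite cabsN cabsM exprMn -lecR => /le_trans; apply.
  rewrite le_eqVlt; apply/orP; left; apply/eqP.
  have tJ : ((t%:C)^*)%R = t%:C by apply/CrealP/complex_realP; exists t.
  rewrite rmorphN !rmorphM/= tJ.
  have tt : (cabs t%:C)%:C ^+ 2 = t%:C ^+ 2 by rewrite cabsE normCK tJ.
  transitivity (s%:C ^+ 2 * (p x)%:C - 2 * s%:C * t%:C * (c * (c^*)%R)
    + (cabs t%:C)%:C ^+ 2 * (cabs c)%:C ^+ 2 * (p y)%:C); first by ring.
  rewrite cc tt !(rmorphXn, rmorphM, rmorphD, rmorphN)/=; ring.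
have c2 : 0 <= cabs c ^+ 2 by rewrite exprn_ge0 ?cabs_ge0.
have [py|py] := eqVneq (p y) 0.
  have [px|px] := eqVneq (p x) 0.
    by have := gen 1 1; rewrite px py; nra.
  (* With [p y = 0], these values of [s] and [t] leave [- (cabs c ^+ 2) ^+ 2 * p x], which forces
     [c = 0]. *)
  have := gen (cabs c ^+ 2) (p x); have : 0 < p x by rewrite lt_def px p0.
  rewrite py; move: c2; set C := cabs c ^+ 2; set X := p x => C0 X0 g.
  rewrite mulr0 leNgt; apply/negP => C1.
  have : 0 < C * C * X by do 2?apply: mulr_gt0.
  by rewrite !mulr0 addr0 in g; lra.
have := gen (p y) 1; have : 0 < p y by rewrite lt_def py p0.
move: c2; set C := cabs c ^+ 2; set Y := p y; set X := p x => C0 Y0 g.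
have : 0 <= Y * (X * Y - C) by nra.
by rewrite pmulr_rge0// subr_ge0.
Qed.

Lemma cauchy_schwarz x y : cabs '[x, y] <= rnorm x * rnorm y.
Proof.
have I0 : bpos (1 : 'B(H)) by move=> u /=; rewrite innerxx ler0c exprn_ge0// rnorm_ge0.
have := bpos_cauchy_schwarz x y I0; rewrite /= !innerxx /= -exprMn.
by rewrite ler_pXn2r// nnegrE ?mulr_ge0 ?rnorm_ge0 ?cabs_ge0.
Qed.
End PosOp.

(** * Coercive functionals: Riesz representation and inverses *)

Section Riesz.
Local Open Scope complex_scope.
Context (R : realType) (H : hilbertType R).
Implicit Types (x y z : H).

(** The first-order condition at a minimum. At [t = - c / (q + 1)] the value is a negative multiple
    of [c ^+ 2]; the added 1 covers [q = 0]. *)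
Lemma linear_coef_eq0 (q c : R) : 0 <= q ->
  (forall t, 0 <= t ^+ 2 * q + 2 * t * c) -> c = 0.
Proof.
move=> q0 /(_ (- c / (q + 1))) h.
have q1 : 0 < q + 1 by lra.
have : 0 <= (q + 1) ^+ 2 * ((- c / (q + 1)) ^+ 2 * q + 2 * (- c / (q + 1)) * c).
  by rewrite mulr_ge0// exprn_ge0// ltW.
have -> : (q + 1) ^+ 2 * ((- c / (q + 1)) ^+ 2 * q + 2 * (- c / (q + 1)) * c) =
  - (c ^+ 2 * (q + 2)) by field; rewrite gt_eqF.
rewrite oppr_ge0 pmulr_lle0; last by lra.
by move=> c2; apply/eqP; rewrite -sqrf_eq0 eq_le c2 sqr_ge0.
Qed.

Lemma invS_cvg0 : (n.+1%:R^-1 : R) @[n --> \oo] --> (0 : R).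
Proof. exact: cvg_harmonic. Qed.

(* Minimises [<A x, x> - 2 Re (f x)]; [A = 1] is the Riesz representation
   theorem, and [f = <., y>] solves [A x = y]. *)
Lemma coercive_riesz (A : 'B(H)) (d M : R) (f : H -> R[i]) :
  0 < d -> bpos A -> (forall x, d * rnorm x ^+ 2 <= complex.Re '[A x, x]) ->
  (forall k x y, f (k *: x + y) = k * f x + f y) ->
  (forall x, cabs (f x) <= M * rnorm x) ->
  exists y, forall z, f z = '[z, A y].
Proof.
move=> d0 A0 Ad fl fM.
pose q x := complex.Re '[A x, x]; pose g x := complex.Re (f x).
pose phi x := q x - 2 * g x.
have fZD (t : R) x y : f (y + t%:C *: x) = t%:C * f x + f y by rewrite addrC fl.
have qE x : '[A x, x] = (q x)%:C by rewrite Re_eqC.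
have q0 x : 0 <= q x by rewrite -lecR -qE; exact: A0.
have qD x y (t : R) : q (x + t%:C *: y) =
    q x + t ^+ 2 * q y + 2 * t * complex.Re '[A x, y].
  have tJ : ((t%:C)^*)%R = t%:C by apply/CrealP/complex_realP; exists t.
  apply: complexI; rewrite -qE linearD linearZ !innerE tJ !qE.
  rewrite (bpos_self_adjoint A0 y x) (innerC y (A x)).
  rewrite !(rmorphD, rmorphXn, rmorphM)/=.
  have := addcJ '[A x, y]; rewrite [_^*](_ : _ = ('[A x, y]^*)%R)// => h.
  transitivity ((q x)%:C + t%:C ^+ 2 * (q y)%:C + t%:C * (2 * (complex.Re '[A x, y])%:C)).
    by rewrite -h; ring.
  by rewrite -[1%:C]/(1 : R[i]); ring.
have gD x y (t : R) : g (x + t%:C *: y) = g x + t * g y.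
  rewrite /g fZD raddfD/= addrC; congr (_ + _).
  by case: (f y) => u v /=; rewrite mul0r subr0.
have phiD x y t : phi (x + t%:C *: y) =
   phi x + t ^+ 2 * q y + 2 * t * (complex.Re '[A x, y] - g y).
  by rewrite /phi qD gD; ring.
have gM x : g x <= M * rnorm x by apply: le_trans (fM x); exact: ler_Re_cabs.
have phi_lb x : - (M ^+ 2 / d) <= phi x.
  rewrite /phi; have := Ad x; have := gM x; rewrite -/(q x).
  set n := rnorm x => h1 h2.
  have : 0 <= d * (n - M / d) ^+ 2 by rewrite mulr_ge0 ?sqr_ge0 ?ltW.
  have -> : d * (n - M / d) ^+ 2 = d * n ^+ 2 - 2 * (M * n) + M ^+ 2 / d.
    by field; rewrite gt_eqF.
  lra.
have hinf : has_inf (range phi).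
  by split; [exists (phi 0), 0|exists (- (M ^+ 2 / d)) => _ [x _ <-]].
pose m := inf (range phi).
have phim x : m <= phi x by apply: ge_inf; [case: hinf|exists x].
pose e (n : nat) : R := n.+1%:R^-1.
have e0 n : 0 < e n by rewrite invr_gt0.
(* The slack [d / 2 * e n ^+ 2] is chosen for the midpoint argument: since [phi] is at least [m] at
   the midpoint of [u n] and [u k], it gives [rnorm (u n - u k) ^+ 2 <= e n ^+ 2 + e k ^+ 2]. *)
have /choice[u uE] : forall n, exists x, phi x < m + d / 2 * e n ^+ 2.
  move=> n; have en : 0 < d / 2 * e n ^+ 2 by rewrite mulr_gt0 ?exprn_gt0 ?divr_gt0.
  by have [_ [x _ <-] ?] := inf_adherent en hinf; exists x.
have ue n k : rnorm (u n - u k) <= e n + e k.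
  have := phim (u k + (2^-1)%:C *: (u n - u k)).
  have := phiD (u k) (u n - u k) 1; rewrite scale1r addrC subrK phiD => h1 h2.
  have := uE n; have := uE k; have := Ad (u n - u k); rewrite -/(q _).
  move: h1 h2; set r := complex.Re _ - _; set Q := q _; set N := rnorm _ => h1 h2 h3 h4 h5.
  have N2 : d * N ^+ 2 <= d * (e n ^+ 2 + e k ^+ 2) by lra.
  rewrite ler_pM2l// in N2.
  have ee : N ^+ 2 <= (e n + e k) ^+ 2.
    by have := e0 n; have := e0 k; nra.
  by rewrite -(@ler_pXn2r _ 2%N)// nnegrE ?rnorm_ge0// addr_ge0// ltW.
have [l ul] := cauchy_bound invS_cvg0 ue.
have ReE z : complex.Re (f z) = complex.Re '[z, A l].
  suff /eqP : complex.Re '[A l, z] - g z = 0.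
    by rewrite subr_eq0 -/(g z) => /eqP <-; rewrite [in RHS]innerC; case: inner.
  apply: (linear_coef_eq0 (q0 z)) => t.
  apply: (@le_lim0 _ e (d / 2 + 2 * `|t| * opnorm A * rnorm z) _ _ invS_cvg0) => n.
  have := phim (u n + t%:C *: z); have := uE n; rewrite phiD => h1 h2.
  have : `|complex.Re '[A (u n), z] - complex.Re '[A l, z]| <= opnorm A * e n * rnorm z.
    rewrite -raddfB/= -innerBl -linearB.
    apply: (@le_trans _ _ (cabs '[A (u n - l), z])).
      by rewrite -lecR cabsE; exact: normc_ge_Re.
    apply: le_trans (cauchy_schwarz _ _) _; rewrite ler_wpM2r ?rnorm_ge0//.
    apply: le_trans (le_opnorm _ _) _; rewrite ler_wpM2l ?opnorm_ge0//; exact: ul.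
  set a := complex.Re '[A (u n), z]; set b := complex.Re '[A l, z] => h3.
  have h4 : t * (a - b) <= `|t| * (opnorm A * e n * rnorm z).
    by apply: le_trans (ler_norm _) _; rewrite normrM ler_wpM2l.
  have e1 : d / 2 * e n ^+ 2 <= d / 2 * e n.
    apply: ler_wpM2l; first by rewrite divr_ge0 ?ltW.
    rewrite expr2; apply: ler_piMl; first exact: ltW.
    by rewrite invf_le1 ?ler1n.
  lra.
exists l => z; apply/eqP; rewrite eq_complex ReE eqxx/=.
(* The imaginary part at [z] is, up to sign, the real part at [i z]. *)
have := ReE ('i%C *: z); have := fl 'i%C z 0; rewrite addr0 => ->.
have -> : f 0 = 0 by have := fl (-1) 0 0; rewrite scaler0 addr0 mulN1r addNr.
by rewrite addr0 innerZl !(mulrC 'i%C) !ReiNIm => /oppr_inj ->.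
Qed.

Lemma bpos1 : bpos (1 : 'B(H)).
Proof. by move=> x /=; rewrite innerxx ler0c exprn_ge0 ?rnorm_ge0. Qed.

(** Lax-Milgram: [coercive_riesz] solves [A x = y], and the bound [d * rnorm x <= rnorm (A x)] makes
    the solution unique and its dependence on [y] bounded by [d^-1]. *)
Lemma coercive_invertible (A : 'B(H)) (d : R) :
  0 < d -> bpos A -> (forall x, d * rnorm x ^+ 2 <= complex.Re '[A x, x]) ->
  binvertible A.
Proof.
move=> d0 A0 Ad.
have /choice[B AB] : forall y, exists x, A x = y.
  move=> y; have [||x yx] := @coercive_riesz A d (rnorm y) (fun z => '[z, y]) d0 A0 Ad.
  - by move=> k x z; rewrite innerDl innerZl.
  - by move=> x; rewrite mulrC cauchy_schwarz.
  by exists x; apply: inner_inj.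
have lb x : d * rnorm x <= rnorm (A x).
  have [->|x0] := eqVneq x 0; first by rewrite rnorm0 mulr0 rnorm_ge0.
  have xp : 0 < rnorm x by rewrite lt_def rnorm_eq0 x0 rnorm_ge0.
  rewrite -(ler_pM2r xp) -mulrA -expr2; apply: le_trans (Ad x) _.
  by apply: le_trans (ler_Re_cabs _) _; exact: cauchy_schwarz.
have inj x y : A x = A y -> x = y.
  move=> xy; have Axy : A (x - y) = 0 by rewrite linearB /= xy subrr.
  apply/eqP; rewrite -subr_eq0 -rnorm_eq0 eq_le rnorm_ge0 andbT.
  by rewrite -(pmulr_rle0 _ d0) (le_trans (lb _))// Axy rnorm0.
have Bl : linear B by move=> k x y; apply: inj; rewrite (bop_linear A) !AB.
have [|B' B'E] := bop_of_bound (M := d^-1) Bl.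
  by move=> x; rewrite ler_pdivlMl// -{2}(AB x) lb.
by exists B'; split; apply: bopP => x /=; [rewrite B'E AB|apply: inj; rewrite B'E AB].
Qed.

End Riesz.

Section Adjoint.
Local Open Scope complex_scope.
Context (R : realType).

(** Riesz gives the adjoint vector by vector; its boundedness follows from
    [rnorm (B u) ^+ 2 = <A (B u), u>]. *)
Lemma badjP (H K : hilbertType R) (A : 'B(H, K)) x y : '[A x, y] = '[x, A^*o y].
Proof.
suff [B AB] : exists B : 'B(K, H), forall x y, '[A x, y] = '[x, B y].
  move: x y; rewrite /badj.
  exact: (@xgetPex _ 0 [set B : 'B(K, H) | forall x y, '[A x, y] = '[x, B y]] (ex_intro _ B AB)).
have /choice[B AB] : forall y, exists z, forall x, '[A x, y] = '[x, z].
  move=> {x}{y} y.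
  have [||||z zE] := @coercive_riesz _ _ 1 1 (opnorm A * rnorm y) (fun x => '[A x, y]) _ (@bpos1 _ _).
  - by [].
  - by move=> x; rewrite mul1r innerxx.
  - by move=> k x z; rewrite linearP innerDl innerZl.
  - move=> x; apply: le_trans (cauchy_schwarz _ _) _.
    by rewrite mulrAC ler_wpM2r ?rnorm_ge0 ?le_opnorm.
  by exists z.
have Bl : linear B.
  move=> k u v; apply: inner_inj => z.
  by rewrite -AB innerDr innerZr !AB innerDr innerZr.
have BM u : rnorm (B u) <= opnorm A * rnorm u.
  have [->|u0] := eqVneq (B u) 0; first by rewrite rnorm0 mulr_ge0 ?opnorm_ge0 ?rnorm_ge0.
  have up : 0 < rnorm (B u) by rewrite lt_def rnorm_eq0 u0 rnorm_ge0.
  rewrite -(ler_pM2r up) -expr2.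
  apply: (@le_trans _ _ (cabs '[B u, B u])).
    by rewrite innerxx cabsR ?exprn_ge0 ?rnorm_ge0.
  rewrite -AB; apply: le_trans (cauchy_schwarz _ _) _.
  by rewrite mulrAC ler_wpM2r ?rnorm_ge0 ?le_opnorm.
have [B' B'E] := bop_of_bound Bl BM.
by exists B' => z t; rewrite B'E.
Qed.

Lemma badjPr (H K : hilbertType R) (A : 'B(H, K)) x y : '[x, A y] = '[A^*o x, y].
Proof. by rewrite innerC badjP -innerC. Qed.

End Adjoint.

Section OpnormLimits.
Local Open Scope complex_scope.
Context (R : realType).

Lemma opnorm_eq0 (V W : normedModType R[i]) (A : 'B(V, W)) : opnorm A <= 0 -> A = 0.
Proof.
move=> A0; apply: bopP => x; apply/eqP; rewrite -rnorm_eq0 eq_le rnorm_ge0 andbT.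
by apply: le_trans (le_opnorm A x) _; rewrite mulr_le0_ge0 ?rnorm_ge0.
Qed.

Lemma opnormD (V W : normedModType R[i]) (A B : 'B(V, W)) :
  opnorm (A + B) <= opnorm A + opnorm B.
Proof.
apply: opnorm_le => [|x]; first by rewrite addr_ge0 ?opnorm_ge0.
by apply: le_trans (rnormD _ _) _; rewrite mulrDl lerD ?le_opnorm.
Qed.

Lemma opnormZ (V W : normedModType R[i]) k (A : 'B(V, W)) :
  opnorm (k *: A) <= cabs k * opnorm A.
Proof.
apply: opnorm_le => [|x]; first by rewrite mulr_ge0 ?opnorm_ge0 ?cabs_ge0.
by rewrite /= rnormZ -mulrA ler_wpM2l ?cabs_ge0 ?le_opnorm.
Qed.

Lemma opnormN (V W : normedModType R[i]) (A : 'B(V, W)) : opnorm (- A) = opnorm A.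
Proof. by congr sup; apply: eq_imagel => x _ /=; rewrite normrN. Qed.

Lemma opnormB (V W : normedModType R[i]) (A B : 'B(V, W)) :
  opnorm (A - B) <= opnorm A + opnorm B.
Proof. by rewrite -(opnormN B) opnormD. Qed.

Lemma opnorm_distC (V W : normedModType R[i]) (A B : 'B(V, W)) :
  opnorm (A - B) = opnorm (B - A).
Proof. by rewrite -opnormN opprB. Qed.

Lemma opnormMr (V : normedModType R[i]) (A B : 'B(V)) :
  opnorm (A * B) <= opnorm A * opnorm B.
Proof. exact: opnormM. Qed.

End OpnormLimits.

(** * Positive square roots *)

Section SquareRoot.
Local Open Scope complex_scope.
Context (R : realType) (H : hilbertType R).
Implicit Types (A B C L : 'B(H)) (x y : H).

(** [0 <= z] in [R[i]] also says that the imaginary part vanishes; that part is estimated as the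
    real part after multiplication by [i]. *)
Lemma ge0_closed (z : R[i]) (w : nat -> R[i]) (K : R) (e : nat -> R) :
  e n @[n --> \oo] --> (0 : R) -> (forall n, 0 <= w n) ->
  (forall n, cabs (w n - z) <= K * e n) -> 0 <= z.
Proof.
move=> e0 w0 wz; rewrite lecE/=; apply/andP; split; last first.
  apply: (@le_lim0 _ e K _ _ e0) => n.
  apply: le_trans (_ : complex.Re (w n) <= _); first by rewrite -lecR Re_eqC.
  rewrite -lerBlDl; apply: le_trans (wz n).
  by rewrite -raddfB/=; exact: ler_Re_cabs.
rewrite -normr_eq0 eq_le normr_ge0 andbT.
apply: (@le_lim0 _ e K _ _ e0) => n; rewrite add0r.
apply: le_trans (wz n).
apply: (@le_trans _ _ (cabs ((w n - z) * 'i%C))); last first.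
  by rewrite cabsM [X in _ * X](_ : _ = 1) ?mulr1// /cabs complexiE normCi.
apply: le_trans (_ : `|complex.Re ((w n - z) * 'i%C)| <= _); last first.
  by rewrite -lecR cabsE normc_ge_Re.
by rewrite ReiNIm normrN raddfB/= (ger0_Im (w0 n)) sub0r normrN.
Qed.

Lemma bpos_closed (A : nat -> 'B(H)) L (e : nat -> R) :
  e n @[n --> \oo] --> (0 : R) -> (forall n, opnorm (A n - L) <= e n) ->
  (forall n, bpos (A n)) -> bpos L.
Proof.
move=> e0 AL A0 x.
apply: (@ge0_closed _ (fun n => '[A n x, x]) (rnorm x ^+ 2) e e0) => n; first exact: A0.
rewrite -innerBl; apply: le_trans (cauchy_schwarz ((A n - L) x) x) _.
rewrite expr2 mulrC -mulrA ler_wpM2l ?rnorm_ge0// mulrC.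
by apply: le_trans (le_opnorm _ _) _; rewrite ler_wpM2r ?rnorm_ge0.
Qed.

(* Converges to [1 - sqrt (1 - C)]; the scalar iteration at [C = 1] dominates
   the increments in norm. *)
Fixpoint sqrt_iter C (n : nat) : 'B(H) :=
  if n is n'.+1 then (2^-1)%:C *: (C + sqrt_iter C n' * sqrt_iter C n') else 0.

Fixpoint sqrt_iter1 (n : nat) : R :=
  if n is n'.+1 then 2^-1 * (1 + sqrt_iter1 n' ^+ 2) else 0.

(** The gap [x = 1 - b] obeys [x' = x - x ^+ 2 / 2], so it decays like 2 divided by the index. *)
Lemma sqrt_iter1_bounds n : 0 <= sqrt_iter1 n /\ 1 - sqrt_iter1 n <= 2 / n.+2%:R /\ sqrt_iter1 n <= 1.
Proof.
elim: n => [|n [b0 [bn b1]]] /=; first by rewrite subr0 divff//.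
have b2 := sqr_ge0 (sqrt_iter1 n).
split; first by nra.
split; last by nra.
set b := sqrt_iter1 n in b0 bn b1 b2 *.
have m0 : (0 : R) < n.+2%:R by [].
have m1 : (2 : R) <= n.+2%:R by rewrite ler_nat.
have -> : n.+3%:R = n.+2%:R + 1 :> R by rewrite -natr1.
set m : R := n.+2%:R in bn m0 m1 *.
set t := 2 / m in bn.
have t1 : t <= 1 by rewrite ler_pdivrMr// mul1r.
have -> : 1 - 2^-1 * (1 + b ^+ 2) = (1 - b) - 2^-1 * (1 - b) ^+ 2 by field.
(* The map [x - x ^+ 2 / 2] is increasing on [[0, 1]], so the bound [t] may replace [1 - b]. *)
apply: (@le_trans _ _ (t - 2^-1 * t ^+ 2)); first by nra.
rewrite -subr_ge0 /t.
have -> : 2 / (m + 1) - (2 / m - 2^-1 * (2 / m) ^+ 2) = 2 / (m ^+ 2 * (m + 1)).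
  by field; rewrite !gt_eqF//; lra.
by rewrite divr_ge0// mulr_ge0 ?exprn_ge0//; lra.
Qed.

Lemma sqrt_iter1_cvg : (1 - sqrt_iter1 n) @[n --> \oo] --> (0 : R).
Proof.
apply: (@squeeze_cvgr _ _ _ _ (fun=> 0) (fun n => 2 * (n.+1%:R^-1))).
- near=> n; have [b0 [bn b1]] := sqrt_iter1_bounds n; rewrite subr_ge0 b1/=.
  apply: le_trans bn _; rewrite ler_wpM2l// lef_pV2 ?posrE//.
  by rewrite ler_nat.
- exact: cvg_cst.
- by rewrite -(mulr0 2); apply: cvgMr; exact: invS_cvg0.
Unshelve. all: by end_near. Qed.

(** The increments are dominated by those of the scalar iteration and telescope to [1 - b n]. The
    limit satisfies [2 L = C + L ^+ 2], which is [(1 - L) ^+ 2 = 1 - C]; positivity of [1 - L] comes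
    from [opnorm (B n) <= 1]. *)
Lemma sqrt_contraction C : bpos C -> opnorm C <= 1 ->
  exists B, bpos B /\ B * B = 1 - C.
Proof.
move=> C0 C1; pose B := sqrt_iter C; pose b := sqrt_iter1; pose e n := 1 - b n.
have half0 : 0 <= (2^-1 : R) by rewrite invr_ge0.
have bS n : b n.+1 = 2^-1 * (1 + b n ^+ 2) by [].
have BSE n : B n.+1 = (2^-1)%:C *: (C + B n * B n) by [].
have b0 n : 0 <= b n by case: (sqrt_iter1_bounds n).
have b1 n : b n <= 1 by case: (sqrt_iter1_bounds n) => _ [].
have e0 n : 0 <= e n by rewrite subr_ge0.
have BC n : opnorm (B n) <= b n.
  elim: n => [|n IH] /=.
    by apply: opnorm_le => // x; rewrite mul0r rnorm0.
  apply: le_trans (opnormZ _ _) _; rewrite cabsR// ler_wpM2l//.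
  apply: le_trans (opnormD _ _) _; rewrite lerD//.
  apply: le_trans (opnormMr _ _) _; rewrite expr2.
  by apply: ler_pM => //; exact: opnorm_ge0.
have Bpos n : bpos (B n).
  elim: n => [|n IH] x /=; first by rewrite inner0l.
  rewrite innerZl innerDl; apply: mulr_ge0; first by rewrite ler0c.
  apply: addr_ge0; first exact: C0.
  by rewrite (bpos_self_adjoint IH) innerxx ler0c exprn_ge0 ?rnorm_ge0.
have BS n : opnorm (B n.+1 - B n) <= b n.+1 - b n.
  elim: n => [|n IH].
    by rewrite [B 0%N]/= [b 0%N]/= !subr0; exact: BC.
  (* A difference of squares written as [x (x - y) + (x - y) y], valid in any ring. *)
  have -> : B n.+2 - B n.+1 = (2^-1)%:C *: (B n.+1 * (B n.+1 - B n) + (B n.+1 - B n) * B n).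
    rewrite (BSE n.+1) [X in _ - X = _]BSE -scalerBr.
    congr (_ *: _); rewrite mulrBr mulrBl addrA subrK.
    by rewrite opprD addrACA subrr add0r.
  apply: le_trans (opnormZ _ _) _; rewrite cabsR//.
  have -> : b n.+2 - b n.+1 = 2^-1 * (b n.+1 * (b n.+1 - b n) + (b n.+1 - b n) * b n).
    by rewrite bS [X in _ - X = _]bS; ring.
  rewrite ler_wpM2l//; apply: le_trans (opnormD _ _) _; apply: lerD.
    by apply: le_trans (opnormMr _ _) _; apply: ler_pM => //; exact: opnorm_ge0.
  by apply: le_trans (opnormMr _ _) _; apply: ler_pM => //; exact: opnorm_ge0.
have Bk n k : opnorm (B (k + n)%N - B n) <= b (k + n)%N - b n.
  elim: k => [|k IH]; first by rewrite !add0n !subrr; apply: opnorm_le => // x; rewrite mul0r rnorm0.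
  rewrite -(subrK (B (k + n)%N) (B (k.+1 + n)%N)) -addrA.
  apply: le_trans (opnormD _ _) _; have := BS (k + n)%N; rewrite -addSn; lra.
have Bc n m : opnorm (B n - B m) <= e n + e m.
  wlog nm : n m / (n <= m)%N.
    move=> h; have [/h//|/ltnW/h] := leqP n m; by rewrite opnorm_distC (addrC (e n)).
  rewrite opnorm_distC -(subnK nm); apply: le_trans (Bk _ _) _.
  by rewrite /e; have := b1 (m - n + n)%N; lra.
have [L BL] := opnorm_complete e0 sqrt_iter1_cvg Bc.
have L1 : opnorm L <= 1.
  have -> : L = B 0%N - (B 0%N - L) by rewrite opprB addrC subrK.
  apply: le_trans (opnormB _ _) _; have := BL 0%N; have := BC 0%N.
  by rewrite /e /=; lra.
have LE : L = (2^-1)%:C *: (C + L * L).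
  apply/eqP; rewrite -subr_eq0; apply/eqP/opnorm_eq0.
  apply: (@le_lim0 _ e 2 _ _ sqrt_iter1_cvg) => n; rewrite add0r.
  have -> : L - (2^-1)%:C *: (C + L * L) = - (B n.+1 - L) +
     (2^-1)%:C *: (B n * (B n - L) + (B n - L) * L).
    rewrite opprB mulrBr mulrBl addrA subrK /= -/(B n) -[RHS]addrA; congr (_ + _).
    by rewrite BSE -!scalerN -scalerDr; congr (_ *: _); rewrite !opprD -[RHS]addrA addKr.
  have en : e n.+1 <= e n by rewrite /e /=; have := b1 n; have := b0 n; rewrite /b; nra.
  apply: le_trans (opnormD _ _) _; rewrite opnormN.
  have h1 := BL n.+1; have := BL n; have Bn1 := le_trans (BC n) (b1 n) => h2.
  have h3 : opnorm ((2^-1)%:C *: (B n * (B n - L) + (B n - L) * L)) <= 2^-1 * (1 * e n + e n * 1).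
    apply: le_trans (opnormZ _ _) _; rewrite cabsR// ler_wpM2l//.
    apply: le_trans (opnormD _ _) _; apply: lerD; apply: le_trans (opnormMr _ _) _;
      apply: ler_pM => //; exact: opnorm_ge0.
  lra.
exists (1 - L); split.
  apply: (@bpos_closed (fun n => 1 - B n) _ e sqrt_iter1_cvg) => n.
    by rewrite opprB addrC addrA subrK opnorm_distC.
  move=> x; rewrite innerBl /= innerxx -(Re_eqC (Bpos n x)) -rmorphB/= ler0c subr_ge0.
  apply: le_trans (ler_Re_cabs _) _; apply: le_trans (cauchy_schwarz _ _) _.
  rewrite expr2 ler_wpM2r ?rnorm_ge0//; apply: le_trans (le_opnorm _ _) _.
  by rewrite -[leRHS]mul1r ler_wpM2r ?rnorm_ge0// (le_trans (BC n)).
have L2 : L + L = C + L * L.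
  rewrite {1 2}LE -scalerDl -rmorphD/= [_ + _](_ : _ = 1) ?scale1r//.
  by field.
rewrite mulrBr mulr1 mulrBl mul1r opprB.
have -> : L * L = L + L - C by rewrite L2 addrAC subrr add0r.
by rewrite (addrAC (L + L)) addrK addrA subrK.
Qed.

(** Cauchy-Schwarz for the form of [C] at [x] and [C x] bounds [rnorm (C x) ^+ 4] by
    [rnorm x ^+ 2 * rnorm (C x) ^+ 2]. *)
Lemma bpos_contraction C : bpos C -> bpos (1 - C) -> opnorm C <= 1.
Proof.
move=> C0 C1; apply: opnorm_le => // x; rewrite mul1r.
have le1 y : complex.Re '[C y, y] <= rnorm y ^+ 2.
  have := C1 y; rewrite innerBl /= innerxx -(Re_eqC (C0 y)) -rmorphB/= ler0c.
  by rewrite subr_ge0.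
have [->|Cx] := eqVneq (C x) 0; first by rewrite rnorm0 rnorm_ge0.
have Cp : 0 < rnorm (C x) by rewrite lt_def rnorm_eq0 Cx rnorm_ge0.
have := bpos_cauchy_schwarz x (C x) C0.
rewrite innerxx cabsR ?exprn_ge0 ?rnorm_ge0// => h.
have : (rnorm (C x) ^+ 2) ^+ 2 <= (rnorm x * rnorm (C x)) ^+ 2.
  apply: le_trans h _; rewrite exprMn; apply: ler_pM => //.
    by rewrite -lecR Re_eqC; exact: C0.
  by rewrite -lecR Re_eqC; exact: C0.
rewrite ler_pXn2r// ?nnegrE ?mulr_ge0 ?exprn_ge0 ?rnorm_ge0//.
by rewrite expr2 ler_pM2r.
Qed.

(** Dividing by [k = opnorm A + 1], positive even for [A = 0], writes [A / k] as [1 - C] with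
    [0 <= C <= 1]; the root is then scaled back. *)
Lemma bsqrtP A : bpos A -> bpos (bsqrt A) /\ bsqrt A * bsqrt A = A.
Proof.
move=> A0; suff [B AB] : exists B, bpos B /\ B * B = A.
  exact: (@xgetPex _ 0 [set B : 'B(H) | bpos B /\ B * B = A] (ex_intro _ B AB)).
pose k := opnorm A + 1.
have k0 : 0 < k by rewrite ltr_wpDl ?opnorm_ge0.
have ReA x : 0 <= complex.Re '[A x, x] by rewrite -lecR Re_eqC; exact: A0.
pose C := 1 - (k^-1)%:C *: A.
have CE x : '[C x, x] = (rnorm x ^+ 2 - k^-1 * complex.Re '[A x, x])%:C.
  by rewrite innerBl innerZl /= innerxx -[in LHS](Re_eqC (A0 x)) -rmorphM -rmorphB.
have C0 : bpos C.
  move=> x; rewrite CE ler0c subr_ge0 ler_pdivrMl//.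
  apply: le_trans (ler_Re_cabs _) _; apply: le_trans (cauchy_schwarz _ _) _.
  rewrite expr2 mulrA ler_wpM2r ?rnorm_ge0//; apply: le_trans (le_opnorm _ _) _.
  by rewrite ler_wpM2r ?rnorm_ge0// lerDl.
have C1 : bpos (1 - C).
  rewrite opprB addrC subrK => x; rewrite innerZl; apply: mulr_ge0; last exact: A0.
  by rewrite ler0c invr_ge0 ltW.
have [B [B0 BB]] := sqrt_contraction C0 (bpos_contraction C0 C1).
exists ((Num.sqrt k)%:C *: B); split.
  move=> x; rewrite innerZl; apply: mulr_ge0; last exact: B0.
  by rewrite ler0c sqrtr_ge0.
apply: bopP => x; rewrite /= linearZ scalerA -rmorphM/= -expr2 sqr_sqrtr ?ltW//.
have -> : B (B x) = (1 - C) x by rewrite -BB.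
by rewrite /C opprB addrC subrK /= scalerA -rmorphM/= divff ?gt_eqF// scale1r.
Qed.

End SquareRoot.

(** * Dense ranges and unitary extensions *)

Section IsometricExtension.
Local Open Scope complex_scope.
Context (R : realType).

Definition dense_range (V W : normedModType R[i]) (A : 'B(V, W)) :=
  forall y (e : R), 0 < e -> exists x, rnorm (A x - y) <= e.

Lemma eq_of_dense (U V W : normedModType R[i]) (A : 'B(U, V)) (B C : 'B(V, W)) :
  dense_range A -> (forall x, B (A x) = C (A x)) -> B = C.
Proof.
move=> Ad BC; apply: bopP => y; apply/eqP; rewrite -subr_eq0 -rnorm_eq0.
rewrite eq_le rnorm_ge0 andbT; apply: (@le_lim0 _ _ (opnorm (B - C)) _ _ (@invS_cvg0 R)) => n.
rewrite add0r; have [|x Ax] := Ad y n.+1%:R^-1; first by rewrite invr_gt0.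
have -> : B y - C y = (B - C) (y - A x) by rewrite linearB /= BC subrr subr0.
by apply: le_trans (le_opnorm _ _) _; rewrite ler_wpM2l ?opnorm_ge0// rdistC.
Qed.

Lemma isometric_extension (V : normedModType R[i]) (W1 : normedModType R[i])
    (W2 : completeNormedModType R[i]) (A : 'B(V, W1)) (B : 'B(V, W2)) :
  (forall x, rnorm (A x) = rnorm (B x)) -> dense_range A ->
  exists U : 'B(W1, W2), (forall y, rnorm (U y) = rnorm y) /\ forall x, U (A x) = B x.
Proof.
move=> AB Ad; pose e n : R := n.+1%:R^-1.
have e0 n : 0 < e n by rewrite invr_gt0.
have ABd x y : rnorm (B x - B y) = rnorm (A x - A y) by rewrite -!linearB/= AB.
(* [U y] is characterised by vectors whose images under [A] and [B] approximate [y] and [U y]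
   simultaneously; linearity, isometry and [U (A x) = B x] all follow from this property. *)
have /choice[U UP] : forall y, exists z, forall n,
    exists x, rnorm (A x - y) <= e n /\ rnorm (B x - z) <= e n.
  move=> y; have /choice[h hP] := fun n => Ad y (e n) (e0 n).
  have [|z Bz] := @cauchy_bound _ _ (fun n => B (h n)) e (@invS_cvg0 R).
    move=> n m; rewrite ABd; apply: le_trans (rnorm_triangle _ y _) _.
    by apply: lerD; [exact: hP|rewrite rdistC; exact: hP].
  by exists z => n; exists (h n); split; [exact: hP|exact: Bz].
have le0 (K : R) (t : W2) : (forall n, rnorm t <= K * e n) -> t = 0.
  move=> tK; apply/eqP; rewrite -rnorm_eq0 eq_le rnorm_ge0 andbT.
  by apply: (@le_lim0 _ _ K _ _ (@invS_cvg0 R)) => n; rewrite add0r; exact: tK.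
have Ul : linear U.
  move=> k y z; apply/eqP; rewrite -subr_eq0; apply/eqP.
  (* Each of the three approximations contributes an error through [A] and one through [B], with
     weights 1, [cabs k] and 1. *)
  apply: (le0 (2 * (2 + cabs k))) => n.
  have [x1 [a1 b1]] := UP (k *: y + z) n.
  have [x2 [a2 b2]] := UP y n; have [x3 [a3 b3]] := UP z n.
  have ka2 : cabs k * rnorm (A x2 - y) <= cabs k * e n by rewrite ler_wpM2l ?cabs_ge0.
  have kb2 : cabs k * rnorm (B x2 - U y) <= cabs k * e n by rewrite ler_wpM2l ?cabs_ge0.
  have -> : U (k *: y + z) - (k *: U y + U z) =
     - (B x1 - U (k *: y + z)) + (B x1 - B (k *: x2 + x3)) +
     (k *: (B x2 - U y) + (B x3 - U z)).
    rewrite (bop_linear B) scalerBr [X in _ = _ + X]addrACA -(opprD (k *: U y)).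
    by rewrite opprB [X in _ = X + _]addrA subrK addrA subrK.
  have h1 := rnormD (- (B x1 - U (k *: y + z)) + (B x1 - B (k *: x2 + x3)))
     (k *: (B x2 - U y) + (B x3 - U z)).
  have h2 := rnormD (- (B x1 - U (k *: y + z))) (B x1 - B (k *: x2 + x3)).
  have h3 := rnormD (k *: (B x2 - U y)) (B x3 - U z).
  have h4 := rnorm_triangle (A x1) (k *: y + z) (A (k *: x2 + x3)).
  have h5 : k *: y + z - A (k *: x2 + x3) = - (k *: (A x2 - y) + (A x3 - z)).
    by rewrite (bop_linear A) scalerBr addrACA -(opprD (k *: y)) opprB.
  have h6 := rnormD (k *: (A x2 - y)) (A x3 - z).
  rewrite h5 rnormN in h4; rewrite rnormZ in h6; rewrite rnormZ in h3.
  rewrite rnormN ABd in h2.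
  lra.
have UN y : rnorm (U y) = rnorm y.
  apply/eqP; rewrite eq_le; apply/andP; split;
    apply: (@le_lim0 _ _ 2 _ _ (@invS_cvg0 R)) => n; have [x [a b]] := UP y n.
    have := rnormD (B x) (- (B x - U y)); rewrite opprB addrC subrK rdistC.
    have := rnormD (A x - y) y; rewrite subrK AB -/(e n); lra.
  have := rnormD (A x) (- (A x - y)); rewrite opprB addrC subrK rdistC.
  have := rnormD (B x - U y) (U y); rewrite subrK AB -/(e n); lra.
have [|U' U'E] := bop_of_bound (M := 1) Ul; first by move=> y; rewrite UN mul1r.
exists U'; split=> [y|x]; rewrite U'E//.
apply/eqP; rewrite -subr_eq0; apply/eqP; apply: (le0 2) => n.
have [t [a b]] := UP (A x) n.
have := rnorm_triangle (U (A x)) (B t) (B x); rewrite rdistC (rdistC (U _)) ABd.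
lra.
Qed.

(** A form that vanishes on the diagonal is positive, so its Cauchy-Schwarz inequality kills the
    other values too. *)
Lemma form_eq0 (H : hilbertType R) (A : 'B(H)) : (forall x, '[A x, x] = 0) -> A = 0.
Proof.
move=> A0; have Ap : bpos A by move=> x; rewrite A0.
apply: bopP => x; apply: inner_eq0 => y.
have := bpos_cauchy_schwarz x y Ap; rewrite !A0 /= mul0r => h.
have /eqP : cabs '[A x, y] ^+ 2 = 0 by apply/eqP; rewrite eq_le h sqr_ge0.
by rewrite sqrf_eq0 cabs_eq0 => /eqP xy; rewrite innerC xy rmorph0.
Qed.

Lemma isometry_adj (H K : hilbertType R) (U : 'B(H, K)) :
  (forall x, rnorm (U x) = rnorm x) -> U^*o *o U = 1.
Proof.
move=> UN; apply/eqP; rewrite -subr_eq0; apply/eqP; apply: form_eq0 => x.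
by rewrite innerBl /= -badjPr !innerxx UN subrr.
Qed.

(** The isometry [W] built in the opposite direction is a right inverse of [U]; with [U^* U = 1] it
    must be the adjoint. *)
Lemma unitary_extension (V : normedModType R[i]) (H K : hilbertType R)
    (A : 'B(V, H)) (B : 'B(V, K)) :
  (forall x, rnorm (A x) = rnorm (B x)) -> dense_range A -> dense_range B ->
  exists U : 'B(H, K), bunitary U /\ forall x, U (A x) = B x.
Proof.
move=> AB Ad Bd.
have [U [UN UA]] := isometric_extension AB Ad.
have [W [WN WB]] := isometric_extension (fun x => esym (AB x)) Bd.
have UW : U *o W = 1 by apply: (eq_of_dense Bd) => x /=; rewrite WB UA.
have UU := isometry_adj UN.
have UE : U^*o = W.
  apply: bopP => y; rewrite -[in LHS](_ : U (W y) = y).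
    by rewrite -[LHS]/((U^*o *o U) (W y)) UU.
  by rewrite -[LHS]/((U *o W) y) UW.
by exists U; split=> //; split=> //; rewrite UE.
Qed.
End IsometricExtension.

(** * Polynomial functional calculus *)

Section CoefSum.
Context (A : nzRingType) (W : zmodType) (phi : nat -> {additive A -> W}).
Implicit Types p q : {poly A}.

(** [poly_op] is a sum of this kind at both levels of its bivariate polynomial, so one argument
    serves for either variable. *)
Definition coef_sum p : W := \sum_(j < size p) phi j p`_j.

Lemma coef_sum_widen p n : (size p <= n)%N -> coef_sum p = \sum_(j < n) phi j p`_j.
Proof.
move=> pn; rewrite /coef_sum (big_ord_widen n (fun j => phi j p`_j) pn).
rewrite [RHS](bigID (fun j : 'I_n => (j < size p)%N)) /= [X in _ = _ + X]big1 ?addr0//.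
by move=> j; rewrite -leqNgt => pj; rewrite nth_default// raddf0.
Qed.

Lemma coef_sumD p q : coef_sum (p + q) = coef_sum p + coef_sum q.
Proof.
rewrite (@coef_sum_widen (p + q) (maxn (size p) (size q))) ?size_polyD//.
rewrite (@coef_sum_widen p (maxn (size p) (size q))) ?leq_maxl//.
rewrite (@coef_sum_widen q (maxn (size p) (size q))) ?leq_maxr//.
by rewrite -big_split; apply: eq_bigr => j _; rewrite coefD raddfD.
Qed.

Lemma coef_sum_is_additive : {morph coef_sum : p q / p - q}.
Proof.
move=> p q; rewrite coef_sumD; congr (_ + _); apply: (addrI (coef_sum q)).
by rewrite -coef_sumD !subrr /coef_sum size_poly0 big_ord0.
Qed.

Lemma coef_sumMX p : coef_sum ('X * p) = \sum_(j < size p) phi j.+1 p`_j.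
Proof.
rewrite (@coef_sum_widen _ (size p).+1); last first.
  by rewrite (leq_trans (size_polyMleq _ _))// size_polyX.
rewrite big_ord_recl coefXM eqxx raddf0 add0r.
by apply: eq_bigr => j _; rewrite coefXM.
Qed.

Lemma coef_sumZ c p : coef_sum (c *: p) = \sum_(j < size p) phi j (c * p`_j).
Proof.
rewrite (@coef_sum_widen _ (size p)) ?size_scale_leq//.
by apply: eq_bigr => j _; rewrite coefZ.
Qed.

End CoefSum.

Section PolyOp.
Context (R : realType) (H : hilbertType R) (S P : 'B(H)).
Implicit Types p q : {poly {poly R[i]}}.

Lemma bscalerAl k (A B : 'B(H)) : k *: A * B = k *: (A * B).
Proof. exact: bopP. Qed.

Lemma bscalerAr k (A B : 'B(H)) : A * (k *: B) = k *: (A * B).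
Proof. by apply: bopP => x /=; rewrite linearZ. Qed.

Let term (j k : nat) (c : R[i]) : 'B(H) := c *: (S ^+ j * P ^+ k).
Let term_additive j k : {morph term j k : c d / c - d}.
Proof. by move=> c d; rewrite /term scalerBl. Qed.
HB.instance Definition _ j k := GRing.isZmodMorphism.Build _ _ (term j k) (term_additive j k).

Let row j := coef_sum (fun k => [the {additive _ -> _} of term j k]).
HB.instance Definition _ j := GRing.isZmodMorphism.Build _ _ (row j)
  (coef_sum_is_additive (fun k => [the {additive _ -> _} of term j k])).

Let poly_opE p : poly_op S P p = coef_sum (fun j => [the {additive _ -> _} of row j]) p.
Proof. by []. Qed.

Lemma poly_opD p q : poly_op S P (p + q) = poly_op S P p + poly_op S P q.
Proof. by rewrite !poly_opE coef_sumD. Qed.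

Lemma poly_opB p q : poly_op S P (p - q) = poly_op S P p - poly_op S P q.
Proof. by rewrite !poly_opE coef_sum_is_additive. Qed.

Lemma poly_op1 : poly_op S P 1 = 1.
Proof.
rewrite /poly_op size_poly1 big_ord1 coef1 eqxx size_poly1 big_ord1 coef1 eqxx.
by rewrite !expr0 mulr1 scale1r.
Qed.

Lemma poly_opZ (c : R[i]) p : poly_op S P (c%:P *: p) = c *: poly_op S P p.
Proof.
rewrite !poly_opE coef_sumZ scaler_sumr; apply: eq_bigr => j _ /=.
rewrite mul_polyC /row coef_sumZ scaler_sumr; apply: eq_bigr => k _ /=.
by rewrite /term scalerA.
Qed.

Lemma poly_opX p : poly_op S P ('X * p) = S * poly_op S P p.
Proof.
rewrite !poly_opE coef_sumMX mulr_sumr; apply: eq_bigr => j _ /=.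
rewrite /row mulr_sumr; apply: eq_bigr => k _ /=.
by rewrite /term bscalerAr exprS mulrA.
Qed.

Hypothesis SP : S * P = P * S.

(** In each monomial the new [P] has to pass the powers of [S] in front of it; this is where
    commutation enters. *)
Lemma poly_opY p : poly_op S P ('X%R *: p) = P * poly_op S P p.
Proof.
rewrite !poly_opE coef_sumZ mulr_sumr; apply: eq_bigr => j _ /=.
rewrite /row coef_sumMX mulr_sumr; apply: eq_bigr => k _ /=.
by rewrite /term bscalerAr exprS !mulrA (commrX j (esym SP : GRing.comm P S)).
Qed.

Lemma poly_op_comm (A : 'B(H)) p : A * S = S * A -> A * P = P * A ->
  A * poly_op S P p = poly_op S P p * A.
Proof.
move=> AS AP; rewrite /poly_op.
apply: (big_ind (fun B => A * B = B * A)) => [|B C BA CA|j _]; first by rewrite mulr0 mul0r.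
  by rewrite mulrDr mulrDl BA CA.
apply: (big_ind (fun B => A * B = B * A)) => [|B C BA CA|k _]; first by rewrite mulr0 mul0r.
  by rewrite mulrDr mulrDl BA CA.
rewrite bscalerAr bscalerAl; congr (_ *: _).
exact: (commrM (commrX j AS) (commrX k AP)).
Qed.

End PolyOp.

(** * From uniform approximation on the open symmetrized bidisc to operators *)

Section FunCalc.
Local Open Scope complex_scope.
Context (R : realType).
Implicit Types (p q : {poly {poly R[i]}}) (s : R[i]^o * R[i]^o).

Lemma poly_evalD p q s : poly_eval (p + q) s = poly_eval p s + poly_eval q s.
Proof. by rewrite /poly_eval !hornerE. Qed.
Lemma poly_evalB p q s : poly_eval (p - q) s = poly_eval p s - poly_eval q s.
Proof. by rewrite /poly_eval !hornerE. Qed.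
Lemma poly_eval1 s : poly_eval 1 s = 1.
Proof. by rewrite /poly_eval !hornerE. Qed.
Lemma poly_evalX p s : poly_eval ('X * p) s = s.1 * poly_eval p s.
Proof. by rewrite /poly_eval !hornerE. Qed.
Lemma poly_evalY p s : poly_eval ('X%R *: p) s = s.2 * poly_eval p s.
Proof. by rewrite /poly_eval !hornerE. Qed.
Lemma poly_evalZ c p s : poly_eval (c%:P *: p) s = c * poly_eval p s.
Proof. by rewrite /poly_eval !hornerE. Qed.

Lemma spectral_bound (H : hilbertType R) (S P : 'B(H)) p (c : R) :
  Gamma_contraction S P ->
  (forall z1 z2, cabs z1 <= 1 -> cabs z2 <= 1 ->
    cabs (poly_eval p (z1 + z2, z1 * z2)) <= c) ->
  opnorm (poly_op S P p) <= c.
Proof.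
move=> [_ SP] pc; apply: le_trans (SP p) _; apply: ge_sup.
  by exists (cabs (poly_eval p (0 + 0, 0 * 0))), (0 + 0, 0 * 0) => //; exists 0, 0;
    rewrite normr0 ler01.
move=> _ [_ [z1 [z2 [h1 h2 ->]]] <-]; apply: pc; by rewrite -lecR cabsE.
Qed.

(** Along a ray only the variable [t] remains, so boundary points can be reached by letting [t] tend
    to 1. *)
Lemma poly_eval_radial p z1 z2 : exists g : {poly R[i]}, forall t,
  poly_eval p (t * z1 + t * z2, t * z1 * (t * z2)) = g.[t].
Proof.
elim/poly_ind: p => [|p c [g gE]].
  by exists 0 => t; rewrite /poly_eval !hornerE.
exists (g * ((z1 + z2) *: 'X) + (c \Po ((z1 * z2) *: 'X^2))) => t.
rewrite poly_evalD mulrC poly_evalX gE /poly_eval !hornerE horner_comp !hornerE /=.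
by congr (_ + c.[_]); ring.
Qed.

(** This bridges [symG], where approximation is given, and [symGamma], where the spectral inequality
    takes its supremum. *)
Lemma poly_eval_closed p (c : R) :
  (forall z1 z2, cabs z1 < 1 -> cabs z2 < 1 ->
    cabs (poly_eval p (z1 + z2, z1 * z2)) <= c) ->
  forall z1 z2, cabs z1 <= 1 -> cabs z2 <= 1 ->
    cabs (poly_eval p (z1 + z2, z1 * z2)) <= c.
Proof.
move=> pc z1 z2 h1 h2; have [g gE] := poly_eval_radial p z1 z2.
have := gE 1; rewrite !mul1r => ->.
have [M M0 gM] : exists2 M : R, 0 <= M & forall t : R, 0 <= t <= 1 ->
   cabs (g.[1] - g.[t%:C]) <= M * (1 - t).
  (* Dividing out the root at 1 gives a Lipschitz estimate at the end of the ray without any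
     calculus. *)
  have /factor_theorem[q qE] : root (g - g.[1]%:P) 1.
    by rewrite rootE !hornerE subrr.
  have [K K0 qK] : exists2 K : R, 0 <= K & forall t : R, 0 <= t <= 1 -> cabs q.[t%:C] <= K.
    elim/poly_ind: (q) => [|q' d [K K0 qK]].
      by exists 0 => // t _; rewrite horner0 cabs0.
    exists (K + cabs d) => [|t t01]; first by rewrite addr_ge0 ?cabs_ge0.
    rewrite !hornerE; apply: le_trans (cabsD _ _) _; rewrite lerD2r cabsM.
    have /andP[t0 t1] := t01; rewrite cabsR//.
    by rewrite -[leRHS]mulr1; apply: ler_pM => //; [exact: cabs_ge0|exact: qK].
  exists K => // t /[dup] t01 /andP[t0 t1].
  have := congr1 (fun r => r.[t%:C]) qE; rewrite !hornerE => e.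
  rewrite -cabsN opprB e cabsM -(cabsN (_ - _)) opprB -[1]/(1%:C) -rmorphB/=.
  rewrite [X in _ * X]cabsR ?subr_ge0// ler_wpM2r ?subr_ge0//.
  exact: qK.
apply: (@le_lim0 _ _ M _ _ (@invS_cvg0 R)) => n.
have n0 : 0 < (n.+1%:R^-1 : R) by rewrite invr_gt0.
have n1 : (n.+1%:R^-1 : R) <= 1 by rewrite invf_le1 ?ler1n.
move: (n.+1%:R^-1 : R) n0 n1 => i i0 i1; pose t := 1 - i.
have t01 : 0 <= t <= 1 by rewrite /t; apply/andP; split; lra.
have t1 : t < 1 by rewrite /t; lra.
have /andP[t0 _] := t01.
have lt1 z : cabs z <= 1 -> cabs (t%:C * z) < 1.
  move=> z1'; rewrite cabsM cabsR//; apply: le_lt_trans t1.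
  by rewrite -[leRHS]mulr1 ler_wpM2l.
have := pc _ _ (lt1 _ h1) (lt1 _ h2); rewrite gE => h.
have := gM _ t01; have := cabsD (g.[1] - g.[t%:C]) g.[t%:C]; rewrite subrK /t; lra.
Qed.

Lemma uniform_symGP (p_ : nat -> {poly {poly R[i]}}) (f : R[i]^o * R[i]^o -> R[i]^o) :
  {uniform (@symG R), (fun n => poly_eval (p_ n) : _ -> R[i]^o) @ \oo --> f} <->
  forall e : R, 0 < e -> exists N, forall n, (N <= n)%N ->
    forall z1 z2, cabs z1 < 1 -> cabs z2 < 1 ->
      cabs (poly_eval (p_ n) (z1 + z2, z1 * z2) - f (z1 + z2, z1 * z2)) < e.
Proof.
have ltG z1 z2 : cabs z1 < 1 -> cabs z2 < 1 -> (@symG R) (z1 + z2, z1 * z2).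
  by move=> h1 h2; exists z1, z2; split=> //; rewrite -cabsE ltcR.
split=> [pf e e0|pf].
  pose E : set (R[i]^o * R[i]^o) := [set uv | ball uv.1 (e%:C) uv.2].
  have EE : entourage E by exists e%:C => //=; rewrite ltcR.
  have : nbhs (f : {uniform` (@symG R) -> R[i]^o}) [set h | forall y, (@symG R) y -> E (f y, h y)].
    by apply/uniform_nbhs; exists E; split.
  move=> /pf [N _ HN]; exists N => n Nn z1 z2 h1 h2.
  have := HN n Nn _ (ltG _ _ h1 h2); rewrite /E /= -ball_normE /=.
  by rewrite distrC -cabsE ltcR.
move=> B /uniform_nbhs[E [[e e0 eE] EB]].
move: e0 eE; rewrite /= ltcE => /andP[/eqP/= eim e0] eE.
have [N HN] := pf _ e0; exists N => // n /= Nn; apply: EB => _ [z1 [z2 [h1 h2 ->]]].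
apply: eE => /=; rewrite distrC -cabsE ltcE /= -eim eqxx /=.
have lt1 z : `|z| < 1 :> R[i] -> cabs z < 1 by rewrite -cabsE ltcR.
exact: HN (lt1 _ h1) (lt1 _ h2).
Qed.

(** The operator picked by [fun_calc] comes with a sequence [q_] of its own. Both [p_] and [q_]
    approximate [f] on [symG], so their difference is small on [symGamma], hence small at [(S, P)],
    and the two limits agree. *)
Lemma fun_calcE (H : hilbertType R) (S P T : 'B(H)) (f : R[i]^o * R[i]^o -> R[i]^o)
    (p_ : nat -> {poly {poly R[i]}}) (e : nat -> R) :
  Gamma_contraction S P -> e n @[n --> \oo] --> (0 : R) ->
  (forall n z1 z2, cabs z1 < 1 -> cabs z2 < 1 ->
    cabs (poly_eval (p_ n) (z1 + z2, z1 * z2) - f (z1 + z2, z1 * z2)) <= e n) ->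
  (forall n, opnorm (poly_op S P (p_ n) - T) <= e n) ->
  fun_calc S P f = T.
Proof.
move=> G e0 pf pT; have elt d : 0 < d -> exists N, forall n, (N <= n)%N -> e n < d.
  move=> d0; have /cvgrPdist_lt/(_ _ d0)[N _ HN] := e0; exists N => n Nn.
  by have := HN n Nn; rewrite sub0r normrN; apply: le_lt_trans; exact: ler_norm.
have pfu : {uniform (@symG R), (fun n => poly_eval (p_ n) : _ -> R[i]^o) @ \oo --> f}.
  apply/uniform_symGP => d /elt[N HN]; exists N => n Nn z1 z2 h1 h2.
  exact: le_lt_trans (pf n _ _ h1 h2) (HN n Nn).
have pTc : opnorm (poly_op S P (p_ n) - T) @[n --> \oo] --> (0 : R).
  apply: (@squeeze_cvgr _ _ _ _ (fun=> 0) e) => //; last exact: cvg_cst.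
  by apply: nearW => n; rewrite opnorm_ge0 pT.
rewrite /fun_calc; set Q := [set T' | _].
have [q_ [qf qT]] : Q (xget 0 Q) by apply: (@xgetPex _ 0 Q); exists T, p_.
move: qT; set T' := xget 0 Q => qT; apply/eqP; rewrite -subr_eq0; apply/eqP/opnorm_eq0.
apply/ler_addgt0Pr => d d0; rewrite add0r.
(* Four quarters: two for comparing [q_] with [p_] through [f], one for each of the two operator
   limits. *)
have d3 : 0 < d / 4 by rewrite divr_gt0.
have [N1 HN1] := elt _ d3.
have /uniform_symGP/(_ _ d3)[N2 HN2] := qf.
have /cvgrPdist_lt/(_ _ d3)[N3 _ HN3] := qT.
pose n := maxn N1 (maxn N2 N3).
have h1 : e n < d / 4 by apply: HN1; rewrite leq_maxl.
have h3 : opnorm (poly_op S P (q_ n) - T') < d / 4.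
  have := HN3 n; rewrite /= sub0r normrN => h; apply: le_lt_trans (ler_norm _) (h _).
  by rewrite !leq_max leqnn !orbT.
have h2 : opnorm (poly_op S P (q_ n) - poly_op S P (p_ n)) <= d / 2.
  rewrite -poly_opB; apply: spectral_bound => //; apply: poly_eval_closed => z1 z2 z11 z21.
  have := HN2 n _ _ _ z11 z21; rewrite leq_max (leq_max N2) leqnn !orbT => /(_ isT) h.
  have := pf n _ _ z11 z21; rewrite poly_evalB.
  set u := poly_eval (q_ n) _ in h *; set v := poly_eval (p_ n) _; set w := f _ in h * => h'.
  have -> : u - v = (u - w) - (v - w) by rewrite opprB addrA subrK.
  by apply: le_trans (cabsD _ _) _; rewrite cabsN; lra.
have h4 := pT n.
have -> : T' - T = (poly_op S P (q_ n) - poly_op S P (p_ n)) -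
   (poly_op S P (q_ n) - T') + (poly_op S P (p_ n) - T).
  by rewrite opprB [X in _ = X + _]addrC [X in _ = X + _]addrA subrK addrA subrK.
have := opnormD (poly_op S P (q_ n) - poly_op S P (p_ n) - (poly_op S P (q_ n) - T')) (poly_op S P (p_ n) - T).
have := opnormB (poly_op S P (q_ n) - poly_op S P (p_ n)) (poly_op S P (q_ n) - T').
lra.
Qed.

End FunCalc.

(** * The resolvent of a Gamma-contraction *)

Section AffineFactor.
Local Open Scope complex_scope.
Context (R : realType).

(** The outer variable stands for [s1] and the inner one for [s2]. The operators [N], [M] and [T]
    are all instances of [affine_op], the matching operator. *)
Definition affine_poly (c1 c2 c3 : R[i]) (q : {poly {poly R[i]}}) :=
  c1%:P *: ('X * q) + c2%:P *: (('X : {poly R[i]}) *: q) + c3%:P *: q.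

Definition affine_op (H : hilbertType R) (S P : 'B(H)) (c1 c2 c3 : R[i]) : 'B(H) :=
  c1 *: S + c2 *: P + c3 *: (1 : 'B(H)).

Lemma poly_eval_affine c1 c2 c3 q (s : R[i]^o * R[i]^o) :
  poly_eval (affine_poly c1 c2 c3 q) s = (c1 * s.1 + c2 * s.2 + c3) * poly_eval q s.
Proof.
rewrite !poly_evalD !poly_evalZ poly_evalX poly_evalY.
by move: (s.1 : R[i]) (s.2 : R[i]) => s1 s2; ring.
Qed.

Lemma poly_op_affine (H : hilbertType R) (S P : 'B(H)) c1 c2 c3 q : S * P = P * S ->
  poly_op S P (affine_poly c1 c2 c3 q) = affine_op S P c1 c2 c3 * poly_op S P q.
Proof.
move=> SP; rewrite !poly_opD !poly_opZ poly_opX (poly_opY SP).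
by rewrite /affine_op !mulrDl !bscalerAl mul1r.
Qed.

(** The second-order recursion with characteristic roots [A] and [B] reduces to the first-order one
    [xE], in which only a power of [B] is left as a source term. *)
Lemma lin_rec_bound (A B : R[i]) (x : nat -> R[i]) (r : R) :
  0 <= r -> r < 1 -> cabs A <= r -> cabs B <= r ->
  x 0%N = 1 -> x 1%N = A + B - A * B ->
  (forall n, x n.+2 = (A + B) * x n.+1 - A * B * x n) ->
  forall n, cabs (x n) <= 4 / (1 - r) * ((1 + r) / 2) ^+ n.
Proof.
move=> r0 r1 Ar Br x0 x1 xS.
have r1' : 0 < 1 - r by rewrite subr_gt0.
have xE n : x n.+1 = A * x n + B ^+ n.+1 * (1 - A).
  elim: n => [|n IH]; first by rewrite x0 x1; ring.
  by rewrite xS IH (exprS B n.+1); ring.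
(* Tuned so that [r * K + 2 = K * rho], which closes the induction. A rate above [r] is used because
   [A = B] can produce terms of order [n * r ^+ n]. *)
set K := 4 / (1 - r); set rho := (1 + r) / 2.
have K4 : K * (1 - r) = 4 by rewrite /K divfK// gt_eqF.
have rr : r <= rho by rewrite /rho; lra.
have rho0 : 0 <= rho by rewrite /rho; lra.
have rho1 : rho <= 1 by rewrite /rho; lra.
elim=> [|n IH].
  by rewrite x0 cabs1 expr0 mulr1 /K ler_pdivlMr//; lra.
rewrite xE; apply: le_trans (cabsD _ _) _; rewrite !cabsM cabsX.
have h1 : cabs A * cabs (x n) <= r * (K * rho ^+ n).
  by apply: ler_pM => //; exact: cabs_ge0.
have h2 : cabs (1 - A) <= 2.
  by apply: le_trans (cabsD _ _) _; rewrite cabs1 cabsN; lra.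
have h3 : cabs B ^+ n.+1 <= rho ^+ n.
  apply: (@le_trans _ _ (rho ^+ n.+1)).
    by apply: lerXn2r; rewrite ?nnegrE ?cabs_ge0// (le_trans Br).
  by rewrite exprS ler_piMl ?exprn_ge0.
have h4 : cabs B ^+ n.+1 * cabs (1 - A) <= rho ^+ n * 2.
  by apply: ler_pM => //; rewrite ?exprn_ge0 ?cabs_ge0.
apply: le_trans (lerD h1 h4) _.
rewrite exprS.
have -> : r * (K * rho ^+ n) + rho ^+ n * 2 = (r * K + 2) * rho ^+ n by ring.
rewrite (mulrA K); apply: ler_wpM2r; first by rewrite exprn_ge0.
rewrite /rho; lra.
Qed.

End AffineFactor.

Section Resolvent.
Local Open Scope complex_scope.
Context (R : realType) (al : R[i]) (hal : cabs al < 1).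

(** Two consecutive terms are carried to make [w'' = 1 + al s1 w' - al^2 s2 w] a structural
    recursion; the fixed point of that equation is [1 / (1 - al s1 + al^2 s2)]. *)
Fixpoint resolvent_pair (n : nat) : {poly {poly R[i]}} * {poly {poly R[i]}} :=
  if n is n'.+1 then
    let w := resolvent_pair n' in (w.2, 1 + affine_poly al 0 0 w.2 - affine_poly 0 (al ^+ 2) 0 w.1)
  else (0, 1).

(* The [n]-th partial sum of the expansion of [1 / (1 - al s1 + al^2 s2)] in powers of [al]. *)
Definition resolvent_poly n := (resolvent_pair n).1.

Lemma resolvent_polySS n : resolvent_poly n.+2 =
  1 + affine_poly al 0 0 (resolvent_poly n.+1) - affine_poly 0 (al ^+ 2) 0 (resolvent_poly n).
Proof. by []. Qed.

Definition resolvent_err n : R := 4 / (1 - cabs al) * ((1 + cabs al) / 2) ^+ n.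

(** In the coordinates [z1], [z2] the denominator factors, and the residual obeys the homogeneous
    recursion with roots [al * z1] and [al * z2]. *)
Lemma resolvent_poly_approx n z1 z2 : cabs z1 <= 1 -> cabs z2 <= 1 ->
  cabs (1 - (1 - al * z1) * (1 - al * z2) * poly_eval (resolvent_poly n) (z1 + z2, z1 * z2))
    <= resolvent_err n.
Proof.
move=> h1 h2; have le z : cabs z <= 1 -> cabs (al * z) <= cabs al.
  by move=> hz; rewrite cabsM -[leRHS]mulr1 ler_wpM2l ?cabs_ge0.
pose w n : R[i] := poly_eval (resolvent_poly n) (z1 + z2, z1 * z2).
have w0 : w 0%N = 0 by rewrite /w /poly_eval !hornerE.
have w1 : w 1%N = 1 by rewrite /w poly_eval1.
have wS k : w k.+2 = 1 + al * (z1 + z2) * w k.+1 - al ^+ 2 * (z1 * z2) * w k.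
  rewrite /w resolvent_polySS poly_evalB poly_evalD poly_eval1 !poly_eval_affine /=.
  by rewrite !mul0r !addr0 add0r.
apply: (@lin_rec_bound _ (al * z1) (al * z2)
  (fun n => 1 - (1 - al * z1) * (1 - al * z2) * w n)) => //.
- exact: cabs_ge0.
- exact: le.
- exact: le.
- by rewrite w0 mulr0 subr0.
- by rewrite w1; ring.
- by move=> k; rewrite wS; ring.
Qed.

Lemma resolvent_err_cvg (K : R) : K * resolvent_err n @[n --> \oo] --> (0 : R).
Proof.
have h : `|(1 + cabs al) / 2| < 1.
  by rewrite ger0_norm ?divr_ge0 ?addr_ge0 ?cabs_ge0//; have := hal; lra.
have -> : (fun n => K * resolvent_err n) = geometric (K * (4 / (1 - cabs al))) ((1 + cabs al) / 2).
  by apply/funext => n; rewrite /geometric/= /resolvent_err mulrA.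
exact: cvg_geometric.
Qed.

Lemma resolvent_err_ge0 n : 0 <= resolvent_err n.
Proof.
have := hal => h; have := cabs_ge0 al => h0.
by rewrite mulr_ge0 ?exprn_ge0 ?divr_ge0//; lra.
Qed.

Let K := (1 - cabs al)^-1 ^+ 2.

Lemma denom_lb z : cabs z <= 1 -> 1 - cabs al <= cabs (1 - al * z).
Proof.
move=> hz; have := cabsD (1 - al * z) (al * z); rewrite subrK cabs1 cabsM.
have h : cabs al * cabs z <= cabs al * 1 by rewrite ler_wpM2l ?cabs_ge0.
by lra.
Qed.

Lemma denom_neq0 z : cabs z <= 1 -> 1 - al * z != 0.
Proof.
move=> /denom_lb h; rewrite -cabs_eq0 gt_eqF//; apply: lt_le_trans h.
by rewrite subr_gt0.
Qed.

Lemma resolvent_poly_inv n z1 z2 : cabs z1 <= 1 -> cabs z2 <= 1 ->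
  cabs (poly_eval (resolvent_poly n) (z1 + z2, z1 * z2) - ((1 - al * z1) * (1 - al * z2))^-1)
    <= K * resolvent_err n.
Proof.
move=> h1 h2; have := resolvent_poly_approx n h1 h2.
set w : R[i] := poly_eval _ _ => h.
have n1 := denom_neq0 h1; have n2 := denom_neq0 h2.
have -> : w - ((1 - al * z1) * (1 - al * z2))^-1 =
  - ((1 - al * z1)^-1 * (1 - al * z2)^-1 * (1 - (1 - al * z1) * (1 - al * z2) * w)).
  by field; rewrite n1 n2.
have d0 : 0 < 1 - cabs al by rewrite subr_gt0.
have inv z : cabs z <= 1 -> cabs (1 - al * z)^-1 <= (1 - cabs al)^-1.
  move=> hz; rewrite cabsV lef_pV2 ?posrE//; first exact: denom_lb.
  exact: lt_le_trans (denom_lb hz).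
rewrite cabsN !cabsM /K expr2; apply: ler_pM => //.
- by rewrite mulr_ge0 ?cabs_ge0.
- exact: cabs_ge0.
- by apply: ler_pM; rewrite ?cabs_ge0//; exact: inv.
Qed.

Context (H : hilbertType R) (S P : 'B(H)) (SP : Gamma_contraction S P).

Let N := affine_op S P (- al) (al ^+ 2) 1.

(** The residual [N W - 1] is a polynomial small on [symGamma], so it vanishes in the limit; [Q]
    commutes with [N] as a limit of polynomials. The rate is recorded because the same approximants
    later compute [Stau] and [Ptau]. *)
Lemma resolvent_exists : exists Q : 'B(H), [/\ N * Q = 1, Q * N = 1 &
  forall n, opnorm (poly_op S P (resolvent_poly n) - Q) <= K * resolvent_err n].
Proof.
have C : S * P = P * S by case: SP.
pose W n := poly_op S P (resolvent_poly n).
have K0 : 0 <= K by rewrite exprn_ge0// invr_ge0 subr_ge0 ltW.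
have [|n m|Q WQ] := @opnorm_complete _ _ _ W (fun n => K * resolvent_err n) _ (resolvent_err_cvg K).
- by move=> n; rewrite mulr_ge0// resolvent_err_ge0.
- rewrite -poly_opB; apply: spectral_bound => // z1 z2 h1 h2.
  rewrite poly_evalB.
  have := resolvent_poly_inv n h1 h2; have := resolvent_poly_inv m h1 h2.
  set u : R[i] := poly_eval _ _; set v : R[i] := poly_eval _ _; set t := _^-1 => a b.
  have -> : v - u = (v - t) - (u - t) by rewrite opprB addrA subrK.
  by apply: le_trans (cabsD _ _) _; rewrite cabsN lerD.
have NQ : N * Q = 1.
  apply/eqP; rewrite -subr_eq0; apply/eqP/opnorm_eq0.
  apply: (@le_lim0 _ _ 1 _ _ (resolvent_err_cvg (opnorm N * K + 1))) => n.
  rewrite add0r mul1r.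
  have -> : N * Q - 1 = (N * W n - 1) - N * (W n - Q).
    by rewrite mulrBr opprB [RHS]addrC addrA subrK.
  apply: le_trans (opnormB _ _) _; rewrite (mulrDl (opnorm N * K)) mul1r addrC lerD//.
    by apply: le_trans (opnormMr _ _) _; rewrite -mulrA ler_wpM2l ?opnorm_ge0.
  rewrite -poly_op_affine// -(poly_op1 S P) -poly_opB; apply: spectral_bound => // z1 z2 h1 h2.
  rewrite -cabsN; apply: le_trans (resolvent_poly_approx n h1 h2).
  rewrite poly_evalB poly_eval_affine poly_eval1 /=.
  move: (poly_eval _ _ : R[i]) => w.
  by rewrite le_eqVlt; apply/orP; left; apply/eqP; congr cabs; ring.
have QN : N * Q = Q * N.
  have NW n : W n * N = N * W n.
    symmetry; apply: poly_op_comm.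
      by rewrite /N /affine_op !mulrDl !mulrDr !bscalerAl !bscalerAr C mul1r mulr1.
    by rewrite /N /affine_op !mulrDl !mulrDr !bscalerAl !bscalerAr C mul1r mulr1.
  apply/eqP; rewrite -subr_eq0; apply/eqP/opnorm_eq0.
  apply: (@le_lim0 _ _ 1 _ _ (resolvent_err_cvg (2 * opnorm N * K))) => n.
  rewrite add0r mul1r.
  have -> : N * Q - Q * N = (W n - Q) * N - N * (W n - Q).
    by rewrite (mulrBr N) (mulrBl N) NW opprB [RHS]addrC addrA subrK.
  apply: le_trans (opnormB _ _) _.
  have h1 := opnormMr N (W n - Q); have h2 := opnormMr (W n - Q) N.
  have h3 : opnorm N * opnorm (W n - Q) <= opnorm N * (K * resolvent_err n).
    by rewrite ler_wpM2l ?opnorm_ge0.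
  rewrite (mulrC (opnorm (W n - Q))) in h2; lra.
by exists Q; split=> //; rewrite -QN.
Qed.

End Resolvent.

(** * Transfer from dense ranges; two-sided inverses *)

Section Density.
Local Open Scope complex_scope.
Context (R : realType).

Lemma dense_range_comp (V W W' : normedModType R[i]) (A : 'B(V, W)) (B : 'B(W, W')) :
  dense_range A -> (forall y, exists x, B x = y) -> dense_range (B *o A).
Proof.
move=> Ad Bs y e e0; have [v <-] := Bs y.
have B1 : 0 < opnorm B + 1 by rewrite ltr_wpDl ?opnorm_ge0.
have [|x Ax] := Ad v (e / (opnorm B + 1)); first by rewrite divr_gt0.
exists x; rewrite /= -linearB; apply: le_trans (le_opnorm _ _) _.
apply: (@le_trans _ _ ((opnorm B + 1) * (e / (opnorm B + 1)))).
  by apply: ler_pM; rewrite ?opnorm_ge0 ?rnorm_ge0 ?lerDl.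
by rewrite mulrC divfK// gt_eqF.
Qed.

Lemma dense_range_precomp (V' V W : normedModType R[i]) (A : 'B(V, W)) (B : 'B(V', V)) :
  dense_range A -> (forall y, exists x, B x = y) -> dense_range (A *o B).
Proof.
by move=> Ad Bs y e e0; have [v Av] := Ad y e e0; have [x xv] := Bs v; exists x; rewrite /= xv.
Qed.

Lemma bpos_dense (V : normedModType R[i]) (H : hilbertType R) (A : 'B(V, H)) (T : 'B(H)) :
  dense_range A -> (forall x, 0 <= '[T (A x), A x]) -> bpos T.
Proof.
move=> Ad TA y.
have /choice[h hP] : forall n : nat, exists x, rnorm (A x - y) <= n.+1%:R^-1.
  by move=> n; apply: Ad; rewrite invr_gt0.
apply: (@ge0_closed _ _ (fun n => '[T (A (h n)), A (h n)])
  (opnorm T * (rnorm y + 1) + opnorm T * rnorm y) _ (@invS_cvg0 R)) => n; first exact: TA.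
have := hP n; set u := A (h n); set i := n.+1%:R^-1 => hi.
have i1 : i <= 1 by rewrite invf_le1 ?ler1n.
have -> : '[T u, u] - '[T y, y] = '[T (u - y), u] + '[T y, u - y].
  by rewrite linearB innerBl innerBr addrA subrK.
apply: le_trans (cabsD _ _) _; rewrite mulrDl; apply: lerD.
  apply: le_trans (cauchy_schwarz _ _) _; rewrite mulrAC; apply: ler_pM; rewrite ?rnorm_ge0//.
    apply: le_trans (le_opnorm _ _) _; apply: ler_pM; rewrite ?opnorm_ge0 ?rnorm_ge0//.
  have := rnormD y (u - y); rewrite addrC subrK; lra.
apply: le_trans (cauchy_schwarz _ _) _; apply: ler_pM; rewrite ?rnorm_ge0//.
exact: le_opnorm.
Qed.

Lemma inner_eq_of_dense (V : normedModType R[i]) (H : hilbertType R) (A : 'B(V, H)) (u v : H) :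
  dense_range A -> (forall x, '[u, A x] = '[v, A x]) -> u = v.
Proof.
move=> Ad uv; apply/eqP; rewrite -subr_eq0 -rnorm_eq0 -sqrf_eq0 eq_le sqr_ge0 andbT.
set t := u - v.
apply: (@le_lim0 _ _ (rnorm t) _ _ (@invS_cvg0 R)) => n; rewrite add0r.
have [|x Ax] := Ad t n.+1%:R^-1; first by rewrite invr_gt0.
have tA : '[t, A x] = 0 by rewrite /t innerBl uv subrr.
have e : '[t, t] = '[t, t - A x] by rewrite (innerBr t t) tA subr0.
have -> : rnorm t ^+ 2 = cabs '[t, t] by rewrite innerxx cabsR ?exprn_ge0 ?rnorm_ge0.
rewrite e; apply: le_trans (cauchy_schwarz _ _) _.
by rewrite ler_wpM2l ?rnorm_ge0// rdistC.
Qed.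

Lemma binvP (V : normedModType R[i]) (A : 'B(V)) :
  binvertible A -> A * binv A = 1 /\ binv A * A = 1.
Proof. by move=> [B AB]; apply: (@xgetPex _ 0 [set B : 'B(V) | A * B = 1 /\ B * A = 1]); exists B. Qed.

(** The inverse of [A * A] commutes with [A]. This passes invertibility from [X] to its square
    root. *)
Lemma binvertible_sqr (V : normedModType R[i]) (A : 'B(V)) :
  binvertible (A * A) -> binvertible A.
Proof.
move=> [B [AB BA]]; exists (A * B); split; first by rewrite mulrA.
have -> : A * B = B * A.
  transitivity (B * A * (A * A * B)); last by rewrite AB mulr1.
  by rewrite !mulrA -(mulrA B A A) BA mul1r.
by rewrite -mulrA.
Qed.

End Density.

(** * Defect spaces and fundamental operators *)

Section Defect.
Local Open Scope complex_scope.
Context (R : realType) (H : hilbertType R) (P : 'B(H)).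
Hypothesis P1 : forall x, rnorm (P x) <= rnorm x.

Let Dsqrt : bpos (defect P) /\ defect P * defect P = 1 - P^*o * P.
Proof.
apply: bsqrtP => x; rewrite innerBl /= -badjPr !innerxx -rmorphB/= ler0c subr_ge0.
by rewrite ler_pXn2r ?nnegrE ?rnorm_ge0.
Qed.

Lemma defect_self_adjoint x y : '[defect P x, y] = '[x, defect P y].
Proof. by apply: bpos_self_adjoint; case: Dsqrt. Qed.

Lemma defect_form x y : '[defect P x, defect P y] = '[x, y] - '[P x, P y].
Proof.
rewrite -defect_self_adjoint -[defect P (defect P x)]/((defect P * defect P) x).
by case: Dsqrt => _ ->; rewrite innerBl /= -badjPr.
Qed.

(** [to_range] is a bare function; the density lemmas ask for a bounded operator into the defect
    space. *)
Lemma defect_corestriction : exists d : 'B(H, defect_space P),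
  (forall x, d x = to_range (defect P) x) /\ dense_range d.
Proof.
have dl : linear (to_range (defect P)).
  by move=> k x y; apply: val_inj; rewrite /= linearP.
have [|d dE] := bop_of_bound (M := opnorm (defect P)) dl.
  by move=> x; exact: le_opnorm.
exists d; split=> // y e e0.
have /set_mem yc := valP y.
have eC : 0 < e%:C by rewrite ltcR.
have [_ [[x _ <-] /=]] := yc _ (nbhsx_ballx (val y) e%:C eC).
rewrite -ball_normE /= -rnormE ltcR => h; exists x.
by rewrite dE rdistC ltW.
Qed.

(** The right side involves [S] and [P] only. This serves to expand expressions in [F] and, applied
    to [Ftau], to identify that operator. *)
Lemma fundamental_form (S : 'B(H)) (F : 'B(defect_space P)) :
  fundamental_operator S F -> forall x y,
  '[F (to_range (defect P) x), to_range (defect P) y] = '[S x, y] - '[P x, S y].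
Proof.
move=> hF x y; rewrite -[LHS]/('[val (F (to_range (defect P) x)), defect P y]).
by rewrite -defect_self_adjoint -hF innerBl /= -badjPr.
Qed.

End Defect.

(** * Moebius images of a Gamma-contraction *)

Section Moebius.
Local Open Scope complex_scope.
Context (R : realType) (H : hilbertType R) (S P : 'B(H)).
Hypothesis SP : Gamma_contraction S P.

Lemma blaschke_le (a z : R[i]) : cabs a <= 1 -> cabs z <= 1 -> cabs (z - a) <= cabs (1 - (a^*)%R * z).
Proof.
move=> a1 z1; rewrite -(@ler_pXn2r R 2%N)// ?nnegrE ?cabs_ge0// -subr_ge0.
have -> : cabs (1 - (a^*)%R * z) ^+ 2 - cabs (z - a) ^+ 2 = (1 - cabs a ^+ 2) * (1 - cabs z ^+ 2).
  apply: complexI; rewrite !(rmorphB, rmorphXn, rmorphM, rmorph1)/= !cabsE !normCK.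
  by rewrite !(rmorphB, rmorphM, rmorph1)/= conjCK; ring.
by rewrite mulr_ge0// subr_ge0 exprn_ile1 ?cabs_ge0.
Qed.

Section Fixed_a.
Context (a : R[i]) (ha : cabs a < 1).

Let al := (a^*)%R.
Let hal : cabs al < 1. Proof. by rewrite cabsJ. Qed.
Let N := affine_op S P (- al) (al ^+ 2) 1.
Let M := affine_op S P (- a) 1 (a ^+ 2).
Let K := (1 - cabs al)^-1 ^+ 2.
Let K0 : 0 <= K. Proof. by rewrite exprn_ge0// invr_ge0 subr_ge0 ltW. Qed.
Let commSP : S * P = P * S. Proof. by case: SP. Qed.

Lemma cabs_affine_le (c1 c2 c3 z1 z2 : R[i]) : cabs z1 <= 1 -> cabs z2 <= 1 ->
  cabs (c1 * (z1 + z2) + c2 * (z1 * z2) + c3) <= 2 * cabs c1 + cabs c2 + cabs c3.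
Proof.
move=> h1 h2; apply: le_trans (cabsD _ _) _; rewrite lerD2r.
apply: le_trans (cabsD _ _) _; rewrite !cabsM; apply: lerD.
  rewrite mulrC; apply: ler_wpM2r; first exact: cabs_ge0.
  by apply: le_trans (cabsD _ _) _; lra.
rewrite -[leRHS]mulr1 ler_wpM2l ?cabs_ge0//.
by apply: mulr_ile1; rewrite ?cabs_ge0.
Qed.

(** The spectral inequality is applied to the numerator times the approximants of the inverse
    denominator; on [symGamma] this product is a product of two Blaschke factors up to a vanishing
    error. *)
Lemma moebius_numerator_le x : rnorm (M x) <= rnorm (N x).
Proof.
have [Q [NQ QN WQ]] := resolvent_exists hal SP.
suff MQ : opnorm (M * Q) <= 1.
  have -> : M x = (M * Q) (N x) by rewrite -[in LHS](_ : (Q * N) x = x)// QN.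
  apply: le_trans (le_opnorm _ _) _.
  by rewrite -[leRHS]mul1r ler_wpM2r ?rnorm_ge0.
pose B := 2 * cabs (- a) + cabs 1 + cabs (a ^+ 2).
have B0 : 0 <= B by rewrite !addr_ge0 ?mulr_ge0 ?cabs_ge0.
apply: (@le_lim0 _ _ 1 _ _ (resolvent_err_cvg hal ((B + opnorm M) * K))) => n.
rewrite mul1r.
have -> : M * Q = M * poly_op S P (resolvent_poly al n) - M * (poly_op S P (resolvent_poly al n) - Q).
  by rewrite (mulrBr M) opprB [RHS]addrC subrK.
apply: le_trans (opnormB _ _) _.
rewrite (mulrDl B) (mulrDl (B * K)) addrA; apply: lerD; last first.
  by apply: le_trans (opnormMr _ _) _; rewrite -mulrA ler_wpM2l ?opnorm_ge0.
rewrite -poly_op_affine//; apply: spectral_bound => // z1 z2 h1 h2.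
rewrite poly_eval_affine /=.
have := resolvent_poly_inv hal n h1 h2; set w : R[i] := poly_eval _ _ => hw.
have n1 := denom_neq0 hal h1; have n2 := denom_neq0 hal h2.
have -> : (- a * (z1 + z2) + 1 * (z1 * z2) + a ^+ 2) * w =
  (z1 - a) / (1 - al * z1) * ((z2 - a) / (1 - al * z2)) +
  (- a * (z1 + z2) + 1 * (z1 * z2) + a ^+ 2) * (w - ((1 - al * z1) * (1 - al * z2))^-1).
  by field; rewrite n1 n2.
apply: le_trans (cabsD _ _) _; apply: lerD.
  have bl z : cabs z <= 1 -> 1 - al * z != 0 -> cabs ((z - a) / (1 - al * z)) <= 1.
    move=> hz hn; rewrite cabsM cabsV ler_pdivrMr ?mul1r; first exact: blaschke_le (ltW ha) hz.
    by rewrite lt_def cabs_eq0 hn cabs_ge0.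
  rewrite cabsM; apply: mulr_ile1; rewrite ?cabs_ge0//; exact: bl.
rewrite cabsM -mulrA; apply: ler_pM; rewrite ?cabs_ge0//.
exact: cabs_affine_le.
Qed.

(** Both coordinates of [tau] are affine in [s1], [s2] over the same denominator, so one lemma
    identifies [Stau] and [Ptau]. *)
Lemma fun_calc_affine (c1 c2 c3 : R[i]) (f : R[i]^o * R[i]^o -> R[i]^o) (Q : 'B(H)) :
  (forall z1 z2, cabs z1 < 1 -> cabs z2 < 1 -> f (z1 + z2, z1 * z2) =
    (c1 * (z1 + z2) + c2 * (z1 * z2) + c3) / ((1 - al * z1) * (1 - al * z2))) ->
  (forall n, opnorm (poly_op S P (resolvent_poly al n) - Q) <= K * resolvent_err al n) ->
  fun_calc S P f = affine_op S P c1 c2 c3 * Q.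
Proof.
move=> fE WQ.
pose B := 2 * cabs c1 + cabs c2 + cabs c3.
have B0 : 0 <= B by rewrite !addr_ge0 ?mulr_ge0 ?cabs_ge0.
set A := affine_op S P c1 c2 c3.
have err0 n : 0 <= K * resolvent_err al n by rewrite mulr_ge0// resolvent_err_ge0.
have Bn n : B * (K * resolvent_err al n) <= (B + opnorm A) * K * resolvent_err al n.
  by rewrite -mulrA ler_wpM2r// lerDl opnorm_ge0.
have An n : opnorm A * (K * resolvent_err al n) <= (B + opnorm A) * K * resolvent_err al n.
  by rewrite -mulrA ler_wpM2r// lerDr.
apply: (fun_calcE (p_ := fun n => affine_poly c1 c2 c3 (resolvent_poly al n)) SP
  (resolvent_err_cvg hal ((B + opnorm A) * K))) => n.
  move=> z1 z2 h1 h2; apply: le_trans (Bn n).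
  have h1' := ltW h1; have h2' := ltW h2.
  rewrite fE// poly_eval_affine /= -mulrBr cabsM.
  apply: ler_pM; rewrite ?cabs_ge0//; first exact: cabs_affine_le.
  exact: resolvent_poly_inv.
apply: le_trans (An n); rewrite poly_op_affine// -/A -(mulrBr A).
by apply: le_trans (opnormMr _ _) _; rewrite ler_wpM2l ?opnorm_ge0.
Qed.

End Fixed_a.

(** The case [a = 0], where [M = P] and [N = 1]. *)
Lemma Gamma_contraction_contractive x : rnorm (P x) <= rnorm x.
Proof.
have a0 : cabs (0 : R[i]) < 1 by rewrite cabs0.
have := moebius_numerator_le a0 x.
by rewrite /affine_op /= rmorph0 !expr0n/= oppr0 !scale0r !scale1r !add0r addr0.
Qed.

End Moebius.

(** * Form identities for the fundamental operator *)

Section FundamentalOperator.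
Local Open Scope complex_scope.
Context (R : realType) (H : hilbertType R) (S P : 'B(H)).
Hypothesis SP : Gamma_contraction S P.
Context (F : 'B(defect_space P)) (hF : fundamental_operator S F).

(** The operator [X], kept as a function of [a] because its coercivity is obtained by varying
    [a]. *)
Definition moebius_denominator (a : R[i]) : 'B(defect_space P) :=
  (1 + `|a| ^+ 2) *: (1 : 'B(defect_space P)) - (a^*)%R *: F - a *: F^*o.

Let contr : forall x, rnorm (P x) <= rnorm x. Proof. exact: Gamma_contraction_contractive SP. Qed.

Lemma fundamental_adj_form x y :
  '[F^*o (to_range (defect P) x), to_range (defect P) y] = '[x, S y] - '[S x, P y].
Proof.
rewrite -badjPr innerC (fundamental_form contr hF) rmorphB/=.
by rewrite -!innerC.
Qed.

Lemma moebius_numerator_form (a : R[i]) x y :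
  let al := (a^*)%R in
  let N := affine_op S P (- al) (al ^+ 2) 1 in
  let M := affine_op S P (- a) 1 (a ^+ 2) in
  '[N x, N y] - '[M x, M y] = (1 - a * al) *
    '[moebius_denominator a (to_range (defect P) x), to_range (defect P) y].
Proof.
move=> al N M.
rewrite /moebius_denominator /N /M /affine_op /= !innerE.
rewrite -[inner (to_range _ x) (to_range _ y)]/(inner (defect P x) (defect P y)).
rewrite (fundamental_form contr hF) fundamental_adj_form defect_form// normCK.
rewrite !(rmorphN, rmorphXn, rmorph1, rmorphM)/= conjCK -/al; ring.
Qed.

Lemma moebius_sum_form (a : R[i]) x y :
  let al := (a^*)%R in
  let N := affine_op S P (- al) (al ^+ 2) 1 in
  let M := affine_op S P (- a) 1 (a ^+ 2) in
  let T := affine_op S P (1 + a * al) (- (2 * al)) (- (2 * a)) in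
  let Z := F + a ^+ 2 *: F^*o - (2 * a) *: (1 : 'B(defect_space P)) in
  '[T x, N y] - '[M x, T y] = (1 - a * al) *
    '[Z (to_range (defect P) x), to_range (defect P) y].
Proof.
move=> al N M T Z.
rewrite /Z /N /M /T /affine_op /= !innerE.
rewrite -[inner (to_range _ x) (to_range _ y)]/(inner (defect P x) (defect P y)).
rewrite (fundamental_form contr hF) fundamental_adj_form defect_form//.
rewrite !(rmorphN, rmorphXn, rmorph1, rmorphM, rmorphD, rmorph_nat)/= conjCK -/al; ring.
Qed.

Lemma moebius_denominator_pos (a : R[i]) : cabs a < 1 -> bpos (moebius_denominator a).
Proof.
move=> ha; have [d [dE dd]] := defect_corestriction P.
apply: (bpos_dense dd) => x; rewrite dE.
have a2 : cabs a ^+ 2 < 1 by rewrite exprn_ilt1 ?cabs_ge0.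
have r0 : 0 < 1 - a * (a^*)%R.
  by rewrite -normCK -cabsE -rmorphXn subr_gt0 ltcR.
rewrite -(pmulr_rge0 _ r0) -moebius_numerator_form !innerxx -rmorphB ler0c subr_ge0.
rewrite ler_pXn2r ?nnegrE ?rnorm_ge0//.
exact: moebius_numerator_le.
Qed.

(* With [l > 1] and [l |a| < 1], the operator at [a] is [l^-1] times the positive
   operator at [l a], plus the scalar [(1 - l^-1) (1 - l |a|^2)]. *)
Lemma moebius_denominator_coercive (a : R[i]) : cabs a < 1 -> exists2 d : R, 0 < d &
  forall y, d * rnorm y ^+ 2 <= complex.Re '[moebius_denominator a y, y].
Proof.
move=> ha; have r0 := cabs_ge0 a; set r := cabs a in ha r0 *.
(* A factor with [1 < l] and [l * r < 1], given by a formula that also covers [r = 0]. *)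
pose l := 2 / (1 + r).
have l0 : 0 < l by rewrite divr_gt0//; lra.
have lE : l * (1 + r) = 2 by rewrite /l divfK// gt_eqF//; lra.
have l1 : 1 < l by nra.
have lr : l * r < 1 by nra.
have lrr : l * r ^+ 2 < 1 by nra.
have lV : l^-1 < 1 by rewrite invf_lt1.
have cla : cabs (l%:C * a) < 1 by rewrite cabsM cabsR ?ltW.
exists ((1 - l^-1) * (1 - l * r ^+ 2)); first by rewrite mulr_gt0 ?subr_gt0.
move=> y; have h := moebius_denominator_pos cla y.
have LJ : ((l%:C)^*)%R = l%:C by apply/CrealP/complex_realP; exists l.
have L0 : l%:C != 0 by rewrite (inj_eq (@complexI R)) gt_eqF.
have rE : (r ^+ 2)%:C = a * (a^*)%R by rewrite rmorphXn/= cabsE normCK.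
have dE : ((1 - l^-1) * (1 - l * r ^+ 2) * rnorm y ^+ 2)%:C =
    (1 - l%:C^-1) * (1 - l%:C * (a * (a^*)%R)) * (rnorm y ^+ 2)%:C.
  by rewrite -rE -fmorphV -[1 in RHS]/(1%:C) -rmorphM -!rmorphB -!rmorphM.
have -> : '[moebius_denominator a y, y] = (l^-1)%:C * '[moebius_denominator (l%:C * a) y, y]
    + ((1 - l^-1) * (1 - l * r ^+ 2) * rnorm y ^+ 2)%:C.
  rewrite dE /moebius_denominator /= !innerE innerxx !normCK fmorphV.
  have -> : ((l%:C * a)^*)%R = l%:C * (a^*)%R by rewrite rmorphM /= LJ.
  by field.
rewrite raddfD/= lerDr -lecR Re_eqC.
  by rewrite mulr_ge0// ler0c invr_ge0 ltW.
by rewrite mulr_ge0// ler0c invr_ge0 ltW.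
Qed.

End FundamentalOperator.

Theorem theorem2p2 (R : realType) (H : hilbertType R) (S P : 'B(H))
    (hSP : Gamma_contraction S P)
    (tau : R[i]^o * R[i]^o -> R[i]^o * R[i]^o)
    (htau : automorphism_symG tau)
    (a b : R[i]) (ha : `|a| < 1) (hb : `|b| = 1)
    (htau_m : forall z1 z2 : R[i], `|z1| < 1 -> `|z2| < 1 ->
       tau (z1 + z2, z1 * z2) =
         (disc_aut a b z1 + disc_aut a b z2, disc_aut a b z1 * disc_aut a b z2))
    (Stau Ptau : 'B(H)) (hSPtau : (Stau, Ptau) = fun_calc2 S P tau)
    (F : 'B(defect_space P)) (hF : fundamental_operator S F)
    (Ftau : 'B(defect_space Ptau)) (hFtau : fundamental_operator Stau Ftau) :
  let Id : 'B(defect_space P) := 1 in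
  let X := (1 + `|a| ^+ 2) *: Id - a^* *: F - a *: F^*o in
  [/\ bpos X, binvertible X &
      exists U : 'B(defect_space Ptau, defect_space P),
        bunitary U /\
        Ftau = U^*o *o binv (bsqrt X)
                 *o (b *: (F + a ^+ 2 *: F^*o - (2 * a) *: Id))
                 *o binv (bsqrt X) *o U].
Proof.
move=> Id X.
have ha' : cabs a < 1 by rewrite -ltcR cabsE.
have hal : cabs a^* < 1 by rewrite cabsJ.
have Xpos : bpos X := moebius_denominator_pos hSP hF ha'.
have [d d0 Xd] := moebius_denominator_coercive hSP hF ha'.
have Xinv : binvertible X := coercive_invertible d0 Xpos Xd.
split=> //.
have [Q [NQ QN WQ]] := resolvent_exists hal hSP.
set N := affine_op S P _ _ _ in NQ QN.
pose M := affine_op S P (- a) 1 (a ^+ 2).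
pose T := affine_op S P (1 + a * a^*) (- (2 * a^*)) (- (2 * a)).
have bb : b * b^* = 1 by rewrite -normCK hb expr1n.
have denom z1 z2 : cabs z1 < 1 -> cabs z2 < 1 ->
    (1 - a^* * z1 != 0) && (1 - a^* * z2 != 0).
  by move=> h1 h2; rewrite !(denom_neq0 hal)// ltW.
have tauE z1 z2 : cabs z1 < 1 -> cabs z2 < 1 -> tau (z1 + z2, z1 * z2) =
    (disc_aut a b z1 + disc_aut a b z2, disc_aut a b z1 * disc_aut a b z2).
  by move=> h1 h2; apply: htau_m; rewrite -cabsE ltcR.
(* Over the common denominator, [m(z1) + m(z2)] has numerator [b] times
   [(1 + |a|^2) s1 - 2 a^* s2 - 2 a]. *)
have StauE : Stau = b *: (T * Q).
  have -> : Stau = fun_calc S P (fun s => (tau s).1) by case: hSPtau.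
  rewrite (fun_calc_affine hSP ha' (c1 := b * (1 + a * a^*)) (c2 := - (2 * b * a^*))
    (c3 := - (2 * b * a)) _ WQ).
    rewrite -bscalerAl /T /affine_op !scalerDr !scalerA !mulrN !mulrA.
    by rewrite !(mulrC b 2).
  move=> z1 z2 h1 h2; rewrite tauE//= /disc_aut.
  by have /andP[n1 n2] := denom _ _ h1 h2; field; rewrite n1 n2.
have PtauE : Ptau = b ^+ 2 *: (M * Q).
  have -> : Ptau = fun_calc S P (fun s => (tau s).2) by case: hSPtau.
  rewrite (fun_calc_affine hSP ha' (c1 := b ^+ 2 * (- a)) (c2 := b ^+ 2 * 1)
    (c3 := b ^+ 2 * a ^+ 2) _ WQ).
    by rewrite -bscalerAl /M /affine_op !scalerDr !scalerA.
  move=> z1 z2 h1 h2; rewrite tauE//= /disc_aut.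
  by have /andP[n1 n2] := denom _ _ h1 h2; field; rewrite n1 n2.
have NQx x : N (Q x) = x by rewrite -[LHS]/((N * Q) x) NQ.
have QNx x : Q (N x) = x by rewrite -[LHS]/((Q * N) x) QN.
have cb : cabs b = 1 by rewrite /cabs hb.
have Ptau1 x : rnorm (Ptau x) <= rnorm x.
  rewrite PtauE /= rnormZ cabsX cb expr1n mul1r.
  by have := moebius_numerator_le hSP ha' (Q x); rewrite -/N NQx.
have [dP [dPE dPd]] := defect_corestriction P.
have [dT [dTE dTd]] := defect_corestriction Ptau.
have [Ypos YY] := bsqrtP Xpos; set Y := bsqrt X in Ypos YY *.
have [YYi YiY] : Y * binv Y = 1 /\ binv Y * Y = 1.
  by apply/binvP/binvertible_sqr; rewrite YY.
set Yi := binv Y in YYi YiY *.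
have YYix y : Y (Yi y) = y by rewrite -[LHS]/((Y * Yi) y) YYi.
have YiYx y : Yi (Y y) = y by rewrite -[LHS]/((Yi * Y) y) YiY.
have r0 : 0 < 1 - cabs a ^+ 2 by rewrite subr_gt0 exprn_ilt1 ?cabs_ge0.
(* The square root of [1 - |a|^2], the factor common to both form identities; it enters [G] once per
   side and therefore cancels in the formula for [Ftau]. *)
pose k : R[i] := (Num.sqrt (1 - cabs a ^+ 2))%:C%C.
have kJ : k^* = k by apply/CrealP/complex_realP; eexists.
have kk : k * k^* = 1 - a * a^*.
  rewrite kJ -expr2 -rmorphXn/= sqr_sqrtr ?ltW// rmorphB/= rmorphXn/= cabsE normCK.
  by rewrite rmorph1.
have k0 : k != 0 by rewrite (inj_eq (@complexI R) _ 0) gt_eqF// sqrtr_gt0.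
pose G := (k *: Y) *o (dP *o Q).
have GE x : G x = k *: Y (to_range (defect P) (Q x)) by rewrite /G /= dPE.
(* Writing [x = N (Q x)] turns [rnorm x ^+ 2 - rnorm (Ptau x) ^+ 2] into the first form identity at
   [Q x]; [b ^+ 2] has modulus 1 and drops out. *)
have normG x : rnorm (dT x) = rnorm (G x).
  suff : '[dT x, dT x] = '[G x, G x].
    rewrite !innerxx => /(@complexI R) /eqP.
    by rewrite eqrXn2 ?rnorm_ge0// => /eqP.
  rewrite dTE -[LHS]/('[defect Ptau x, defect Ptau x]) defect_form// GE.
  rewrite innerZl innerZr mulrA kk -(bpos_self_adjoint Ypos).
  rewrite -[Y (Y _)]/((Y * Y) _) YY -(moebius_numerator_form hSP hF a (Q x) (Q x)).
  rewrite -/N -/M NQx PtauE /= innerZl innerZr rmorphXn/= mulrA -exprMn bb expr1n.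
  by rewrite mul1r.
(* Density on this side makes [U] onto: [Q] and [k *: Y] are surjective, and the defect operator has
   dense range in its defect space. *)
have Gd : dense_range G.
  apply: dense_range_comp; last first.
    by move=> y; exists (k^-1 *: Yi y); rewrite /= [Y _]linearZ /= YYix scalerA divff// scale1r.
  by apply: dense_range_precomp => // y; exists (N y).
have [U [Uu UE]] := unitary_extension normG dTd Gd.
exists U; split=> //.
(* Uniqueness of the fundamental operator in form language: both sides are tested on the dense range
   of the defect operator of [Ptau]. *)
apply: (eq_of_dense dTd) => x; apply: (inner_eq_of_dense dTd) => y.
pose Z := F + a ^+ 2 *: F^*o - (2 * a) *: Id.
rewrite -[RHS]/('[U^*o (Yi (b *: Z (Yi (U (dT x))))), dT y]) -badjPr !UE !GE.
have YiG z : Yi (k *: Y z) = k *: z by rewrite [Yi _]linearZ /= YiYx.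
rewrite YiG innerZr -(bpos_self_adjoint Ypos) YYix [Z _]linearZ /= !innerZl.
rewrite !dTE (fundamental_form Ptau1 hFtau).
have := moebius_sum_form hSP hF a (Q x) (Q y).
cbv zeta; rewrite -/N -/T -/M NQx -/Z => e.
transitivity (b * (k * k^* * '[Z (to_range (defect P) (Q x)), to_range (defect P) (Q y)])); last first.
  by ring.
have StauEx z : Stau z = b *: T (Q z) by rewrite StauE.
have PtauEx z : Ptau z = b ^+ 2 *: M (Q z) by rewrite PtauE.
rewrite kk -e !StauEx PtauEx !innerZl !innerZr.
(* [<Ptau x, Stau y>] carries the scalar [b ^+ 2 * b^*], which equals [b], so one factor [b] comes
   out of both terms. *)
transitivity (b * '[T (Q x), y] - b * (b * b^*) * '[M (Q x), T (Q y)]); first by ring.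
by rewrite bb; ring.
Qed.
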